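(* Let $(X,\mu)$ be a good Cantor measure space and let $\mathcal I$ be an invariant $\sigma$-ideal with analytic base on $(X,\mu)$. Then $\mathcal I$ is equal to one of the following $\sigma$-ideals: $[X]^{\le 0}$, $[X]^{\le\omega}$, $\mathcal E$, $\mathcal M\cap\mathcal N$, $\mathcal M$, $\mathcal N$, or $[X]^{\le\mathfrak c}$.
   Context: A Cantor measure space $(X,\mu)$ is a topological space $X$ homeomorphic to the Cantor cube $\{0,1\}^\omega$ together with a $\sigma$-additive measure $\mu:\mathcal B(X)\to[0,\infty)$ on the Borel $\sigma$-algebra that is continuous, i.e. $\mu(\{x\})=0$ for every $x\in X$. It is good if moreover $\mu$ is strictly positive ($\mu(U)>0$ for every non-empty open $U\subset X$) and satisfies the Subset Condition: for any clopen sets $U,V\subset X$ with $\mu(U)<\mu(V)$ there is a clopen set $U'\subset V$ with $\mu(U')=\mu(U)$. An ideal on $X$ is a family $\mathcal I$ of subsets of $X$ such that for all $A,B\in\mathcal I$ and $C\subset X$ we have $A\cup B\in\mathcal I$ and $A\cap C\in\mathcal I$; it is a $\sigma$-ideal if $\bigcup\mathcal A\in\mathcal I$ for every countable subfamily $\mathcal A\subset\mathcal I$ (in particular $\emptyset\in\mathcal I$). $\mathcal I$ has analytic base if every $A\in\mathcal I$ is contained in some $B\in\mathcal I$ which is an analytic subset of $X$ (a continuous image of a Polish space). $\mathcal I$ is invariant if $\{h(A):A\in\mathcal I\}=\mathcal I$ for every measure-preserving homeomorphism $h:X\to X$, i.e. homeomorphism with $\mu(h(B))=\mu(B)$ for every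 Borel $B\subset X$. Notation: $[X]^{\le\kappa}$ is the family of subsets of $X$ of cardinality $\le\kappa$ (so $[X]^{\le 0}=\{\emptyset\}$, and $[X]^{\le\mathfrak c}$, with $\mathfrak c$ the cardinality of the continuum, is the family of all subsets of $X$); $\mathcal M$ is the $\sigma$-ideal of meager subsets of $X$; $\mathcal N$ is the $\sigma$-ideal of null sets, i.e. subsets of Borel sets of $\mu$-measure zero; $\mathcal E$ is the $\sigma$-ideal generated by closed null sets, i.e. the family of all subsets of countable unions of closed subsets of $X$ of $\mu$-measure zero. *)

(* Defs.v *)
From mathcomp Require Import all_boot all_order all_algebra.
From mathcomp Require Import all_classical all_reals all_analysis.

Set Implicit Arguments.
Unset Strict Implicit.
Unset Printing Implicit Defensive.

Import Order.TTheory GRing.Theory Num.Theory.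
Import numFieldNormedType.Exports.

Local Open Scope classical_set_scope.
Local Open Scope ring_scope.
Local Open Scope card_scope.
Local Open Scope ereal_scope.

(* [g_sigma_algebraType] needs a pointed carrier, hence [ptopologicalType]; the
   base point plays no role elsewhere. *)
Notation borelType X := (g_sigma_algebraType (@open X)).

Definition homeomorphism (T U : topologicalType) (h : T -> U) : Prop :=
  exists g : U -> T,
    [/\ cancel h g, cancel g h, continuous h & continuous g].

Definition homeomorphic (T U : topologicalType) : Prop :=
  exists h : T -> U, homeomorphism h.

Definition separable_space (T : topologicalType) : Prop :=
  exists2 D : set T, countable D & dense D.

(* The library's [completeType] is pointed, which would exclude the empty
   Polish space and make the empty set non-analytic. *)
Definition metric_complete (R : realType) (M : metricType R) : Prop :=
  forall F : set_system M, ProperFilter F -> cauchy F -> exists l : M, F --> l.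

Definition completely_metrizable (R : realType) (T : topologicalType) : Prop :=
  exists2 M : metricType R, metric_complete M & homeomorphic T M.

Definition polish (R : realType) (T : topologicalType) : Prop :=
  separable_space T /\ completely_metrizable R T.

Definition analytic (R : realType) (X : topologicalType) (A : set X) : Prop :=
  exists2 P : topologicalType, polish R P &
    exists2 f : P -> X, continuous f & A = range f.

Section CantorMeasureSpace.
Context (R : realType) (X : ptopologicalType).
Variable mu : {finite_measure set (borelType X) -> \bar R}.

Definition continuous_measure : Prop := forall x : X, mu [set x] = 0.

Definition cantor_measure_space : Prop :=
  homeomorphic X cantor_space /\ continuous_measure.

Definition strictly_positive : Prop :=
  forall U : set X, open U -> U !=set0 -> 0 < mu U.

Definition subset_condition : Prop :=
  forall U V : set X, clopen U -> clopen V -> mu U < mu V ->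
    exists U' : set X, [/\ clopen U', U' `<=` V & mu U' = mu U].

Definition good_cantor_measure_space : Prop :=
  [/\ cantor_measure_space, strictly_positive & subset_condition].

Definition measure_preserving_homeomorphism (h : X -> X) : Prop :=
  homeomorphism h /\
  forall B : set X, measurable (B : set (borelType X)) -> mu (h @` B) = mu B.

Definition invariant_family (I : set (set X)) : Prop :=
  forall h : X -> X, measure_preserving_homeomorphism h ->
    [set h @` A | A in I] = I.

Definition null_ideal : set (set X) := [set A | mu.-negligible A].

Definition closed_null_ideal : set (set X) :=
  [set A | exists2 F : nat -> set X,
     (forall n, closed (F n) /\ mu (F n) = 0) & A `<=` \bigcup_n F n].

End CantorMeasureSpace.

Definition ideal (X : Type) (I : set (set X)) : Prop :=
  forall A B C : set X, I A -> I B -> I (A `|` B) /\ I (A `&` C).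

Definition sigma_ideal (X : Type) (I : set (set X)) : Prop :=
  ideal I /\
  forall S : set (set X), countable S -> S `<=` I -> I (\bigcup_(A in S) A).

Definition analytic_base (R : realType) (X : topologicalType)
    (I : set (set X)) : Prop :=
  forall A, I A -> exists B, [/\ I B, analytic R B & A `<=` B].

Definition card_le_ideal (X T : Type) (K : set T) : set (set X) :=
  [set A | A #<= K].

Definition nowhere_dense (X : topologicalType) (A : set X) : Prop :=
  interior (closure A) = set0.

Definition meager_ideal (X : topologicalType) : set (set X) :=
  [set A | exists2 F : nat -> set X,
     (forall n, nowhere_dense (F n)) & A = \bigcup_n F n].

Arguments card_le_ideal X {T} K.
Arguments meager_ideal X : clear implicits.

(* Main.v *)
From HB Require Import structures.
Require Import Defs.
From mathcomp Require Import all_boot all_order all_algebra.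
From mathcomp Require Import all_classical all_reals all_analysis.
From mathcomp Require Import lra.

Set Implicit Arguments.
Unset Strict Implicit.
Unset Printing Implicit Defensive.

Import Order.TTheory GRing.Theory Num.Theory.
Import numFieldNormedType.Exports.

Local Open Scope classical_set_scope.
Local Open Scope ring_scope.

(** Because the ideal [I] is invariant, a set belongs to it as soon as some measure-preserving
homeomorphism carries the set into a member of [I], and because [I] has an analytic base
that member can be taken to be the range of a continuous map [f] on a complete separable
metric space. In this way [I] is forced to grow whenever it leaves one of the small ideals:

 - a nonempty member yields all countable sets (lemma [countable_in]);
 - an uncountable member yields all sets covered by closed null sets ([closed_null_in]);
 - a member not covered by closed null sets yields all meager null sets ([meager_null_in]);
 - a non-null member yields all meager sets ([meager_in]);
 - a non-meager member yields all null sets ([null_in]).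

As the space is the union of a meager set and a null set ([meager_null_cover]), the seven
listed ideals are the only ones compatible with these implications.

Two constructions provide the homeomorphisms. The first, [extension], says that a
homeomorphism between closed sets that has small images in a suitable sense, like a
measure-preserving one between nowhere dense sets, extends to a measure-preserving
homeomorphism of the space. It is a back-and-forth with pairs of clopen sets of equal measure,
and the Subset Condition is what lets a splitting of one member of a pair be copied in the
other.

The second, [embedding], moves a closed nowhere dense set [C] into the closure of [f(Q)],
where [Q] is a closed set on which [f] is nowhere small, so that the points of [C] outside
given closed sets [S k] that almost fill [C] go into [f(Q)] itself. To land in [f(Q)], a
point must be followed by open sets of the metric space with diameters tending to [0]. The
obstacle is that the closure of [f(V)] may lose almost all its measure when [V] is replaced by
a smaller open set. So at each stage the part of [C] in one of the sets [S k] is mapped along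
[V] without making [V] small, while a small open subset [W] of [V], the reserve, has been set
aside for the remainder, and [k] is chosen after [W] so that the remainder fits into the
closure of [f(W)]. A point outside all [S k] passes through infinitely many reserves.

For closed null sets one takes the [S k] empty; for a meager null set they are the
complements of small open neighbourhoods of it; for a meager set only the closure of [f(Q)]
matters, which lies in a closed part of the member. The last implication then follows from
the third, since a non-meager analytic set is comeager in some open set. The initial set [Q]
comes from [nowhere_small_part], and the measurability and Baire property of analytic sets
from one argument, [range_contains_hull]. *)

(** * Coordinates on a Cantor space *)

Lemma clopen_setC (T : topologicalType) (A : set T) : clopen A -> clopen (~` A).
Proof. by move=> cA; apply: clopenC => //; exact: set0. Qed.

Lemma clopen_setD (T : topologicalType) (A B : set T) :
  clopen A -> clopen B -> clopen (A `\` B).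
Proof. by move=> cA cB; rewrite setDE; apply: clopenI => //; exact: clopen_setC. Qed.

Section Coding.
Variables (X : topologicalType) (phi : X -> nat -> bool).

Definition agree n (x y : X) := forall k, (k < n)%N -> phi x k = phi y k.

Definition small n (A : set X) := forall x y, A x -> A y -> agree n x y.

(** The smallest clopen set containing [Z] that is decided by [n] coordinates. *)
Definition thicken n (Z : set X) : set X := [set y | exists2 z, Z z & agree n y z].

(** Coordinates on a Cantor space, without reference to a metric: by compactness these three
conditions say that [phi] embeds the space as a closed subset of the Cantor cube. *)
Definition coding :=
  [/\ forall n, clopen [set x | phi x n], injective phi & compact [set: X]].

Lemma agreexx n x : agree n x x. Proof. by []. Qed.

Lemma agree_sym n x y : agree n x y -> agree n y x.
Proof. by move=> a k kn; rewrite a. Qed.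

Lemma agree_trans n x y z : agree n x y -> agree n y z -> agree n x z.
Proof. by move=> a b k kn; rewrite a // b. Qed.

Lemma agree_le n p x y : (n <= p)%N -> agree p x y -> agree n x y.
Proof. by move=> np a k kn; apply: a; apply: leq_trans kn np. Qed.

Lemma agreeS n x y : agree n x y -> phi x n = phi y n -> agree n.+1 x y.
Proof.
move=> a b k; rewrite ltnS leq_eqVlt => /orP [/eqP->//|]; exact: a.
Qed.

Lemma small_sub n A B : A `<=` B -> small n B -> small n A.
Proof. by move=> AB sB x y /AB Bx /AB By; apply: sB. Qed.

Lemma sub_thicken n Z : Z `<=` thicken n Z.
Proof. by move=> z Zz; exists z. Qed.

Lemma thicken_le n p Z : (n <= p)%N -> thicken p Z `<=` thicken n Z.
Proof. by move=> np y [z Zz a]; exists z => //; apply: agree_le a. Qed.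

Lemma thicken_subset n Y Z : Y `<=` Z -> thicken n Y `<=` thicken n Z.
Proof. by move=> YZ y [z /YZ Zz a]; exists z. Qed.

Hypothesis cod : coding.

Lemma cod_bit n : clopen [set x | phi x n]. Proof. by case: cod. Qed.
Lemma cod_inj : injective phi. Proof. by case: cod. Qed.
Lemma cod_compact : compact [set: X]. Proof. by case: cod. Qed.

(** Cantor's intersection theorem; it is used below in place of filters and subcovers. *)
Lemma nested_nonempty (F : nat -> set X) :
  (forall n, closed (F n)) -> (forall n, F n.+1 `<=` F n) ->
  (forall n, F n !=set0) -> exists x, forall n, F n x.
Proof.
move=> clF decF neF.
have [x xF] := choice neF.
have mono n p : (n <= p)%N -> F p `<=` F n.
  elim: p => [|p IH]; first by rewrite leqn0 => /eqP ->.
  by rewrite leq_eqVlt => /orP [/eqP->//|]; rewrite ltnS => /IH np; apply: subset_trans np.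
have [p [_ pF]] := cod_compact (fmap_proper_filter x eventually_filter) filterT.
exists p => n; apply: clF => U Up.
have FnU : (x @ \oo) (F n).
  by exists n => // k /= nk; apply: mono nk _ (xF k).
exact: pF FnU Up.
Qed.

Lemma agree_eq x y : (forall n, agree n x y) -> x = y.
Proof. by move=> a; apply: cod_inj; apply: funext => k; apply: (a k.+1). Qed.

Lemma clopen_agree n x : clopen [set y | agree n y x].
Proof.
elim: n => [|n IH].
  rewrite (_ : [set y | _] = setT); first exact: clopenT.
  by apply/seteqP; split.
rewrite (_ : [set y | _] =
  [set y | agree n y x] `&` (if phi x n then [set y | phi y n] else ~` [set y | phi y n])).
  apply: clopenI => //; case: ifP => _; first exact: cod_bit.
  by apply: clopen_setC; exact: cod_bit.
apply/seteqP; split=> y /=.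
  move=> a; split; first by apply: agree_le a.
  by have := a n (ltnSn n); case: (phi x n) => /= ->.
move=> [a b]; apply: agreeS => //; move: b; case: (phi x n) => //= /negP.
by case: (phi y n).
Qed.

Lemma thicken1 n x : thicken n [set x] = [set y | agree n y x].
Proof. by apply/seteqP; split=> y /=; [case=> z -> | exists x]. Qed.

Lemma open_thicken1 x U : open U -> U x -> exists n, thicken n [set x] `<=` U.
Proof.
move=> oU Ux; apply: contrapT => no.
have [n||p|y yF] := @nested_nonempty (fun n => [set y | agree n y x] `&` ~` U).
- by apply: closedI; [exact: (clopen_agree n x).2|exact: open_closedC].
- by move=> n y [a Uy]; split => //; apply: agree_le a.
- apply/set0P/eqP => h; apply: no; exists p; rewrite thicken1 => y a.
  by apply: contrapT => Uy; rewrite -[False]/(set0 y) -h.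
- have yx : y = x by apply: agree_eq => n; have [] := yF n.
  by have [_] := yF 0%N; rewrite yx.
Qed.

Lemma thicken_open n Z : open (thicken n Z).
Proof.
rewrite (_ : thicken n Z = \bigcup_(z in Z) [set y | agree n y z]).
  by apply: bigcup_open => z _; exact: (clopen_agree n z).1.
by apply/seteqP; split=> y [z Zz a]; exists z.
Qed.

Lemma thicken_setC n Z : thicken n (~` thicken n Z) = ~` thicken n Z.
Proof.
apply/seteqP; split; last exact: sub_thicken.
move=> y [z nz a] [w Zw b]; apply: nz; exists w => //.
by apply: agree_trans b; apply: agree_sym.
Qed.

Lemma clopen_thicken n Z : clopen (thicken n Z).
Proof.
split; first exact: thicken_open.
by rewrite -[thicken n Z]setCK -thicken_setC; apply: open_closedC; exact: thicken_open.
Qed.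

Lemma bigcap_thicken Z : closed Z -> \bigcap_n thicken n Z = Z.
Proof.
move=> clZ; apply/seteqP; split; last by move=> z Zz n _; apply: sub_thicken.
move=> y yZ; apply: contrapT => nZy.
have [n nU] := open_thicken1 (closed_openC clZ) nZy.
have [z Zz a] := yZ n I.
by apply: (nU z) => //; rewrite thicken1; apply: agree_sym.
Qed.

(** A clopen set depends on finitely many coordinates. *)
Lemma clopen_level U : clopen U -> exists n, thicken n U = U.
Proof.
move=> [oU cU]; apply: contrapT => no.
have [n|n y [[z Uz a] Uy]|n|y yF] := @nested_nonempty (fun n => thicken n U `&` ~` U).
- by apply: closedI; [exact: (clopen_thicken n U).2|exact: open_closedC].
- by split=> //; exists z => //; apply: agree_le a.
- apply/set0P/eqP => h; apply: no; exists n; apply/seteqP; split; last exact: sub_thicken.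
  by move=> y ny; apply: contrapT => Uy; rewrite -[False]/(set0 y) -h.
have : (\bigcap_n thicken n U) y by move=> n _; have [] := yF n.
by rewrite bigcap_thicken //; have [_] := yF 0%N.
Qed.

Lemma disjoint_thicken Y Z : closed Y -> closed Z -> Y `&` Z = set0 ->
  exists n, thicken n Y `&` thicken n Z = set0.
Proof.
move=> cY cZ YZ; apply: contrapT => no.
have [n|n y|n|y yF] := @nested_nonempty (fun n => thicken n Y `&` thicken n Z).
- by apply: closedI; [exact: (clopen_thicken n _).2|exact: (clopen_thicken n _).2].
- by case=> [[a Ya ya] [b Zb yb]]; split;
    [exists a => //; apply: agree_le ya|exists b => //; apply: agree_le yb].
- by apply/set0P/eqP => h; apply: no; exists n.
have : (Y `&` Z) y.
  by split; [rewrite -(bigcap_thicken cY)|rewrite -(bigcap_thicken cZ)] => n _; have [] := yF n.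
by rewrite YZ.
Qed.

Lemma clopen_sub_closed A Z : clopen A -> closed Z -> Z `<=` A -> exists n, thicken n Z `<=` A.
Proof.
move=> clA cZ ZA; have [n nA] := clopen_level clA.
by exists n; rewrite -nA; apply: thicken_subset.
Qed.

(** The partition of the space by its first [n] coordinates. *)
Fixpoint cells n : seq (set X) :=
  if n is k.+1 then [seq A `&` [set x | phi x k] | A <- cells k] ++
                    [seq A `\` [set x | phi x k] | A <- cells k]
  else [:: setT].

Lemma cells_cover n x : exists2 A, A \in cells n & A x.
Proof.
elim: n => [|n [A An Ax]]; first by exists setT; rewrite ?inE.
have [b|b] := boolP (phi x n).
  exists (A `&` [set x | phi x n]) => //.
  by rewrite mem_cat; apply/orP; left; apply/mapP; exists A.
exists (A `\` [set x | phi x n]); last by split=> //; apply/negP.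
by rewrite mem_cat; apply/orP; right; apply/mapP; exists A.
Qed.

Lemma cellsP n A : A \in cells n -> clopen A /\ small n A.
Proof.
elim: n A => [A|n IH A].
  by rewrite inE => /eqP ->; split; [exact: clopenT|].
rewrite mem_cat => /orP [] /mapP [B /IH [cB sB] ->]; split.
- by apply: clopenI => //; exact: cod_bit.
- by move=> x y [Bx bx] [By bY]; apply: agreeS; [exact: sB|rewrite bx bY].
- by apply: clopen_setD => //; exact: cod_bit.
move=> x y [Bx bx] [By bY]; apply: agreeS; first exact: sB.
by move: bx bY => /=; case: (phi x n) => // _; case: (phi y n).
Qed.

End Coding.

Lemma homeomorphic_cantor_coding (X : topologicalType) :
  homeomorphic X cantor_space -> exists phi : X -> nat -> bool, coding phi.
Proof.
move=> [h [g [hg gh ch cg]]].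
exists h; split.
- move=> n.
  have cp : continuous (fun x => (h x : prod_topology (fun=> bool)) n).
    move=> x; apply: (@continuous_comp _ _ _ h (proj n)); [exact: ch|exact: proj_continuous].
  have -> : [set x | h x n] = (fun x => (h x : prod_topology (fun=> bool)) n) @^-1` [set true].
    by apply/seteqP; split=> x /=; case: (h x n).
  split; first by apply: open_comp => [x _|]; [exact: cp|exact: discrete_open].
  by apply: preimage_closed => [x _|]; [exact: cp|exact: discrete_closed].
- exact: can_inj hg.
- have -> : [set: X] = g @` [set: cantor_space].
    by apply/seteqP; split=> // x _; exists (h x).
  apply: continuous_compact; last exact: cantor_space_compact.
  by apply: continuous_subspaceT => x; exact: cg.
Qed.

(** * Good measures *)

Section GoodMeasure.
Variables (R : realType) (X : ptopologicalType).
Variable mu : {finite_measure set (borelType X) -> \bar R}.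
Variable phi : X -> nat -> bool.
Hypothesis cod : coding phi.

Local Notation Bor A := (measurable (A : set (borelType X))).

Definition m (A : set X) : R := fine (mu A).

Lemma Bor_open U : open U -> Bor U.
Proof. by move=> oU; apply: sub_sigma_algebra. Qed.

Lemma Bor_closed F : closed F -> Bor F.
Proof.
by move=> cF; rewrite -[F]setCK; apply: measurableC; apply: Bor_open; exact: closed_openC.
Qed.

Lemma Bor_clopen U : clopen U -> Bor U.
Proof. by move=> [/Bor_open]. Qed.

Lemma mE A : Bor A -> mu A = (m A)%:E.
Proof. by move=> BA; rewrite /m fineK // fin_num_measure. Qed.

Lemma m_ge0 A : 0 <= m A.
Proof. by apply: fine_ge0. Qed.

Lemma m0 : m set0 = 0.
Proof. by rewrite /m measure0. Qed.

Lemma le_m A B : Bor A -> Bor B -> A `<=` B -> m A <= m B.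
Proof.
by move=> BA BB AB; rewrite -lee_fin -!mE //; apply: le_measure; rewrite ?inE.
Qed.

Lemma mU A B : Bor A -> Bor B -> A `&` B = set0 -> m (A `|` B) = m A + m B.
Proof.
move=> BA BB AB; apply: EFin_inj; rewrite EFinD -!mE //; last exact: measurableU.
exact: measureU.
Qed.

Lemma mDI A B : Bor A -> Bor B -> m A = m (A `\` B) + m (A `&` B).
Proof.
move=> BA BB; apply: EFin_inj; rewrite EFinD -!mE //; first exact: measureDI.
  exact: measurableI.
exact: measurableD.
Qed.

Lemma mD A B : Bor A -> Bor B -> B `<=` A -> m (A `\` B) = m A - m B.
Proof. by move=> BA BB BsA; rewrite (mDI BA BB) (setIidr BsA) addrK. Qed.

Lemma mU_le A B : Bor A -> Bor B -> m (A `|` B) <= m A + m B.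
Proof.
move=> BA BB; have -> : A `|` B = A `|` (B `\` A).
  by rewrite setDE setUIr setUv setIT.
rewrite mU //; last 2 first.
- exact: measurableD.
- by apply/seteqP; split=> x // [? []].
by rewrite lerD2l; apply: le_m => [||x []//]; first exact: measurableD.
Qed.

Lemma m_nonincreasing (F : nat -> set X) e : (forall n, Bor (F n)) ->
  (forall n p, (n <= p)%N -> F p `<=` F n) -> 0 < e ->
  exists n, m (F n) < m (\bigcap_n F n) + e.
Proof.
move=> BF dF e0.
have BI : Bor (\bigcap_n F n) by apply: bigcapT_measurable.
have nF : nonincreasing_seq (F : nat -> set (borelType X)).
  by move=> n p np; apply/subsetPset; exact: dF.
have F0 : (mu (F 0%N) < +oo)%E by rewrite mE // ltry.
have : (fun n => mu (F n)) @ \oo --> (m (\bigcap_n F n))%:E.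
  by rewrite -mE //; exact: nonincreasing_cvg_mu.
move=> /fine_cvgP[_] /cvgrPdist_lt /(_ _ e0) [n _ /(_ n (leqnn n)) /=].
rewrite -/(m (F n)) -/(m _) => h; exists n; move: h; rewrite ltr_norml => /andP[h _]; lra.
Qed.

Lemma m_thicken Z e : closed Z -> 0 < e -> exists n, m (thicken phi n Z) < m Z + e.
Proof.
move=> cZ e0; have [||n h] := @m_nonincreasing (fun n => thicken phi n Z) e _ _ e0.
- by move=> n; apply: Bor_clopen; exact: clopen_thicken.
- by move=> n p; exact: thicken_le.
by exists n; rewrite (bigcap_thicken cod cZ) in h.
Qed.

Hypothesis cont : continuous_measure mu.

Lemma m1 x : m [set x] = 0. Proof. by rewrite /m cont. Qed.

Lemma closed1 (x : X) : closed [set x].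
Proof.
rewrite (_ : [set x] = \bigcap_n thicken phi n [set x]).
  by apply: closed_bigI => n _; exact: (clopen_thicken cod n _).2.
apply/seteqP; split => y; first by move=> -> n _; apply: sub_thicken.
by move=> h; apply: (agree_eq cod) => n; have := h n I; rewrite thicken1.
Qed.

(** Cylinders of measure at least [e] at every level would form a tree with a branch, that is,
with a point of positive measure. *)
Lemma m_small e : 0 < e -> exists n, forall A, small phi n A -> Bor A -> m A < e.
Proof.
move=> e0; apply: contrapT => no.
pose F n := [set x | e <= m (thicken phi n [set x])].
have nF n x y : agree phi n y x -> F n x -> F n y.
  move=> a; rewrite /F /= !thicken1; suff -> : [set z | agree phi n z y] = [set z | agree phi n z x] by [].
  apply/seteqP; split=> z /=; first by move=> b; apply: agree_trans b a.
  by move=> b; apply: agree_trans b (agree_sym a).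
have [n|n x Fx|n|x xF] := @nested_nonempty _ _ cod F.
- rewrite (_ : F n = thicken phi n (F n)); first exact: (clopen_thicken cod n _).2.
  apply/seteqP; split; first exact: sub_thicken.
  by move=> y [x Fx a]; apply: nF Fx.
- apply: le_trans Fx _; apply: le_m; [by apply: Bor_clopen; apply: clopen_thicken..|exact: thicken_le].
- apply/set0P/eqP => F0; apply: no; exists n => A sA BA.
  have [->|/set0P [x Ax]] := eqVneq A set0; first by rewrite m0.
  apply: (@le_lt_trans _ _ (m (thicken phi n [set x]))).
    apply: le_m => //; first by apply: Bor_clopen; exact: clopen_thicken.
    by move=> y Ay; exists x => //; apply: sA.
  by rewrite ltNge; apply/negP => h; rewrite -[False]/(set0 x) -F0.
have [n] := m_thicken (@closed1 x) e0.
by rewrite m1 add0r ltNge => /negP; apply; exact: xF.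
Qed.

(** Values of a continuous measure on clopen pieces of [K] are dense: cells are added
to [O] one at a time until the measure passes [t]. *)
Lemma m_between K t d : Bor K -> 0 <= t -> t < m K -> 0 < d ->
  exists O, [/\ clopen O, t < m (K `&` O) & m (K `&` O) <= t + d].
Proof.
move=> BK t0 tK d0; have [n nd] := m_small d0.
have : exists s : seq (set X), [/\ forall A, A \in s -> clopen A /\ m A < d &
   t < m (K `&` \big[setU/set0]_(A <- s) A)].
  exists (cells phi n); split.
    by move=> A /(cellsP cod) [cA sA]; split => //; apply: nd => //; exact: Bor_clopen.
  rewrite (_ : \big[setU/set0]_(A <- _) A = setT) ?setIT //.
  apply/seteqP; split => // x _; have [A Ac Ax] := cells_cover phi n x.
  by rewrite -bigcup_seq; exists A.
case=> s [sP]; have Os : clopen (\big[setU/set0]_(A <- s) A).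
  elim: s sP => [|A s IH] sP; first by rewrite big_nil; exact: clopen0.
  rewrite big_cons; apply: clopenU; first by case: (sP A); rewrite ?mem_head.
  by apply: IH => B Bs; apply: sP; rewrite inE Bs orbT.
elim: s sP Os => [|A s IH] sP Os ts; first by move: ts; rewrite big_nil setI0 m0; lra.
have cO : clopen (\big[setU/set0]_(B <- s) B).
  elim: s sP {IH Os ts} => [|B s IH] sP; first by rewrite big_nil; exact: clopen0.
  rewrite big_cons; apply: clopenU; first by case: (sP B); rewrite ?inE ?eqxx ?orbT.
  by apply: IH => C; rewrite inE => Cs; apply: sP; rewrite !inE orbCA Cs orbT.
have [ts'|ts'] := ltP t (m (K `&` \big[setU/set0]_(B <- s) B)).
  by apply: IH => // B Bs; apply: sP; rewrite inE Bs orbT.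
exists (\big[setU/set0]_(B <- A :: s) B); split => //.
have [cA mA] := sP A (mem_head _ _).
rewrite big_cons setIUr.
apply: le_trans (mU_le _ _) _; [by apply: measurableI => //; exact: Bor_clopen..|].
rewrite addrC; apply: lerD => //; apply: le_trans (ltW mA).
by apply: le_m => //; [by apply: measurableI => //; exact: Bor_clopen|exact: Bor_clopen].
Qed.

Hypothesis spos : strictly_positive mu.

Lemma m_gt0 U : open U -> U !=set0 -> 0 < m U.
Proof. by move=> oU U0; rewrite -lte_fin -mE; [exact: spos|exact: Bor_open]. Qed.

(** A closed nowhere dense set leaves out a nonempty open, hence non-null, part of [A]. *)
Lemma m_ndense C A : closed C -> C° = set0 -> clopen A -> A !=set0 -> m (C `&` A) < m A.
Proof.
move=> cC iC cA A0; have BA := Bor_clopen cA; have BC := Bor_closed cC.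
have oD : open (A `\` C) by apply: openI; [exact: cA.1|exact: closed_openC].
rewrite (mDI BA BC) setIC ltrDr; apply: m_gt0 => //.
apply/set0P/eqP => AC0; have [x Ax] := A0.
have AC : A `<=` C by move=> y Ay; apply: contrapT => Cy; rewrite -[False]/(set0 y) -AC0.
by move: AC; rewrite (open_subsetE C cA.1) iC => /(_ _ Ax).
Qed.

Lemma m_nondecreasing (F : nat -> set X) e : (forall n, Bor (F n)) ->
  (forall n p, (n <= p)%N -> F n `<=` F p) -> 0 < e ->
  exists n, m (\bigcup_n F n) < m (F n) + e.
Proof.
move=> BF dF e0.
have [n|n p np|n] := @m_nonincreasing (fun n => ~` F n) e _ _ e0.
- exact: measurableC.
- exact/subsetC/dF.
have BU : Bor (\bigcup_n F n) by exact: bigcupT_measurable.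
have mC A : Bor A -> m (~` A) = m setT - m A.
  by move=> BA; rewrite -setTD mD.
rewrite -setC_bigcup !mC // => h; exists n; lra.
Qed.

(** The sets approximable by a closed set from inside and an open set from outside form a
sigma-algebra, which contains the open sets because a closed set is the intersection of its
thickenings. *)
Lemma regular B e : Bor B -> 0 < e ->
  exists FU : set X * set X, [/\ closed FU.1, open FU.2, FU.1 `<=` B,
    B `<=` FU.2 & m (FU.2 `\` FU.1) < e].
Proof.
pose G := [set B : set X | forall e, 0 < e ->
  exists FU : set X * set X, [/\ closed FU.1, open FU.2, FU.1 `<=` B,
    B `<=` FU.2 & m (FU.2 `\` FU.1) < e]].
move=> BB; move: e; rewrite -/(G B).
suff : <<s @open X >> `<=` G by apply.
apply: smallest_sub; last first.
  move=> U oU e e0; have cZ := open_closedC oU.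
  have [n h] := m_thicken cZ e0; exists (~` thicken phi n (~` U), U) => /=; split => //.
  - by apply: open_closedC; apply: thicken_open.
  - by move=> x nx; apply: contrapT => Ux; apply: nx; apply: sub_thicken.
  - have Bn : Bor (thicken phi n (~` U)) by apply: Bor_clopen; apply: clopen_thicken.
    rewrite setDE setCK; have := mDI Bn (Bor_open oU); have := mDI Bn (Bor_closed cZ).
    rewrite setDE setCK (setIidr (@sub_thicken _ _ _ _)) setIC; lra.
split.
- by move=> e e0; exists (set0, set0); split=> //=; [exact: closed0|exact: open0|rewrite setD0 m0].
- move=> A GA e /GA [[F U] /= [cF oU FA AU h]]; exists (~` U, ~` F) => /=; split.
  + exact: open_closedC.
  + exact: closed_openC.
  + by rewrite setTD; apply: subsetC.
  + by rewrite setTD; apply: subsetC.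
  + by rewrite setDE setCK setIC -setDE.
- move=> A GA e e0.
  (* These errors add up to at most [e / 2]; the other half is spent on stopping the union
     of the closed sets at a finite stage. *)
  have e' n : 0 < e * 2^-1 ^+ n.+2 by rewrite mulr_gt0 // exprn_gt0.
  have [FU FUP] := choice (fun n => GA n _ (e' n)).
  pose F n := (FU n).1; pose U n := (FU n).2.
  have cF n : closed (F n) by have [] := FUP n.
  have oU n : open (U n) by have [] := FUP n.
  pose FF n := \big[setU/set0]_(i < n) F i; pose UU n := \big[setU/set0]_(i < n) U i.
  have cFF n : closed (FF n) by apply: closed_bigsetU.
  have oUU n : open (UU n) by rewrite /UU -bigcup_mkord; apply: bigcup_open.
  have BD n p : Bor (UU n `\` FF p).
    by apply: measurableD; [exact: Bor_open|exact: Bor_closed].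
  have sumle n : m (UU n `\` FF n) <= e / 2 * (1 - 2^-1 ^+ n).
    elim: n => [|n IH]; first by rewrite /UU /FF !big_ord0 setD0 m0 expr0 subrr mulr0.
    have := FUP n => -[_ _ _ _]; rewrite -/(U n) -/(F n) => hn.
    have B1 : Bor (U n `\` F n) by apply: measurableD; [exact: Bor_open|exact: Bor_closed].
    apply: (@le_trans _ _ (m ((UU n `\` FF n) `|` (U n `\` F n)))).
      apply: le_m => //; first exact: measurableU.
      rewrite /UU /FF !big_ord_recr /= => x [[u|u] /not_orP [f1 f2]]; [left|right]; by split.
    apply: le_trans (mU_le (BD _ _) B1) _.
    move: hn IH; rewrite !exprS; set z := 2^-1 ^+ n; lra.
  have BUU : Bor (\bigcup_n UU n).
    by apply: bigcupT_measurable => n; exact: Bor_open.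
  have [|||n hn] := @m_nondecreasing UU (e / 2).
  + by move=> n; exact: Bor_open.
  + by move=> n p np; exact: (@subset_bigsetU _ U).
  + lra.
  have UE : \bigcup_n U n = \bigcup_n UU n.
    apply/seteqP; split=> x [i _ h]; last by have [j _ hj] := @bigsetU_bigcup _ _ _ _ h; exists j.
    by exists i.+1 => //; rewrite /UU big_ord_recr; right.
  exists (FF n, \bigcup_n U n) => /=; split => //.
  + by apply: bigcup_open.
  + rewrite /FF -bigcup_mkord => x [i _ Fx]; exists i => //.
    by have [_ _ h _ _] := FUP i; exact: h.
  + by move=> x [i _ Ax]; exists i => //; have [_ _ _ h _] := FUP i; exact: h.
  + rewrite UE; apply: (@le_lt_trans _ _ (m ((\bigcup_n UU n `\` UU n) `|` (UU n `\` FF n)))).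
      apply: le_m.
      * by apply: measurableD => //; exact: Bor_closed.
      * by apply: measurableU => //; apply: measurableD => //; exact: Bor_open.
      * by move=> x [ux fx]; case: (pselect (UU n x)) => h; [right|left].
    have BUn : Bor (UU n) by exact: Bor_open.
    apply: le_lt_trans (mU_le _ (BD _ _)) _; first exact: measurableD.
    rewrite mD //; last by move=> x ?; exists n.
    have := sumle n; have : 0 < e / 2 * 2^-1 ^+ n by rewrite mulr_gt0 // ?exprn_gt0 //; lra.
    lra.
Qed.

Hypothesis scond : subset_condition mu.

Lemma subset_cond U V : clopen U -> clopen V -> m U < m V ->
  exists U', [/\ clopen U', U' `<=` V & m U' = m U].
Proof.
move=> cU cV UV; have [|U' [cU' U'V e]] := scond cU cV.
  by rewrite !mE ?lte_fin //; exact: Bor_clopen.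
by exists U'; split => //; rewrite /m e.
Qed.

(** This is where the Subset Condition enters: two disjoint clopen sets that are too small can be
enlarged to a partition of [B] with prescribed measures, by adding to [V1] a clopen set of
measure [m A1 - m V1]. *)
Lemma fill A1 A2 B V1 V2 : clopen A1 -> clopen B -> clopen V1 -> clopen V2 ->
  V1 `<=` B -> V2 `<=` B -> V1 `&` V2 = set0 ->
  m B = m A1 + m A2 -> m V1 < m A1 -> m V2 < m A2 ->
  exists B1, [/\ clopen B1, V1 `<=` B1, B1 `<=` B, B1 `&` V2 = set0 & m B1 = m A1].
Proof.
move=> cA cB c1 c2 s1 s2 d12 mB l1 l2.
have BA := Bor_clopen cA; have BB := Bor_clopen cB.
have B1 := Bor_clopen c1; have B2 := Bor_clopen c2.
have [U [cU UA mU1]] := subset_cond c1 cA l1.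
have s12 : V1 `|` V2 `<=` B by move=> x [/s1|/s2].
have [|||W [cW WB mW]] := @subset_cond (A1 `\` U) (B `\` (V1 `|` V2)).
- exact: clopen_setD.
- by apply: clopen_setD => //; apply: clopenU.
- rewrite !mD //; [|exact: measurableU|exact: Bor_clopen]; rewrite mU //; lra.
exists (V1 `|` W); split.
- exact: clopenU.
- by move=> x; left.
- by move=> x [/s1|/WB []].
- apply/seteqP; split=> x // [[v1 v2|/WB [_ h] v2]]; first by rewrite -d12.
  by apply: h; right.
- rewrite mU ?mW ?mD ?mU1 //; [lra|exact: Bor_clopen|exact: Bor_clopen|].
  by apply/seteqP; split=> x // [v1 /WB [_ []]]; left.
Qed.

End GoodMeasure.

(** * Refinements of pairs of sets and their limits *)

Section Refinement.
Variables (R : realType) (X : choiceType) (T : choiceType).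
Variables (E O : T -> set X) (e : T -> R).

(** [L] splits [t]: the pieces are pairwise disjoint on both sides, which is expressed by
counting so that it survives concatenation of lists, and they still cover the points of
[D1] on the left and of [D2] on the right. The budgets [e] bound excess measures, and are
shared among the pieces. *)
Definition refines (D1 D2 : set X) (L : seq T) (t : T) :=
  [/\ forall x, (count (fun c => x \in E c) L <= (x \in E t))%N,
      forall y, (count (fun c => y \in O c) L <= (y \in O t))%N,
      forall x, D1 x -> E t x -> exists2 c, c \in L & E c x,
      forall y, D2 y -> O t y -> exists2 c, c \in L & O c y
    & \sum_(c <- L) e c <= e t].

Lemma refines_subE D1 D2 L t c : refines D1 D2 L t -> c \in L -> E c `<=` E t.
Proof.
move=> [h _ _ _ _] cL x Ecx; rewrite -in_setE -[_ \in _]lt0b.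
by apply: leq_trans (h x); rewrite -has_count; apply/hasP; exists c; rewrite ?in_setE.
Qed.

Lemma refines_subO D1 D2 L t c : refines D1 D2 L t -> c \in L -> O c `<=` O t.
Proof.
move=> [_ h _ _ _] cL x Ocx; rewrite -in_setE -[_ \in _]lt0b.
by apply: leq_trans (h x); rewrite -has_count; apply/hasP; exists c; rewrite ?in_setE.
Qed.

Lemma refines_self D1 D2 t : refines D1 D2 [:: t] t.
Proof. by split=> [x|y|x _ tx|y _ ty|] /=; rewrite ?addn0 ?big_seq1 //; exists t; rewrite ?mem_head. Qed.

Lemma refines0 D1 D2 t : D1 `&` E t = set0 -> D2 `&` O t = set0 -> 0 <= e t ->
  refines D1 D2 [::] t.
Proof.
move=> d1 d2 he; split=> [//|//|x Dx tx|y Dy ty|]; last by rewrite big_nil.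
- by have : (D1 `&` E t) x by []; rewrite d1.
- by have : (D2 `&` O t) y by []; rewrite d2.
Qed.

Lemma refines1 D1 D2 t c : E c `<=` E t -> O c `<=` O t ->
  D1 `&` E t `<=` E c -> D2 `&` O t `<=` O c -> e c <= e t -> refines D1 D2 [:: c] t.
Proof.
have sub (A B : set X) x : A `<=` B -> ((x \in A) + 0 <= (x \in B))%N.
  move=> AB; rewrite addn0; have [xA|//] := boolP (x \in A).
  by rewrite mem_set //; apply: AB; rewrite -in_setE.
move=> sE sO d1 d2 he; split=> [x|y|x Dx tx|y Dy ty|] /=; try exact: sub.
- by exists c; [rewrite mem_head|exact: d1].
- by exists c; [rewrite mem_head|exact: d2].
- by rewrite big_seq1.
Qed.

Lemma refines2 D1 D2 t c d : E c `<=` E t -> E d `<=` E t -> E c `&` E d = set0 ->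
  O c `<=` O t -> O d `<=` O t -> O c `&` O d = set0 ->
  D1 `&` E t `<=` E c `|` E d -> D2 `&` O t `<=` O c `|` O d ->
  e c + e d <= e t -> refines D1 D2 [:: c; d] t.
Proof.
have sub (A A' B : set X) x : A `<=` B -> A' `<=` B -> A `&` A' = set0 ->
    ((x \in A) + ((x \in A') + 0) <= (x \in B))%N.
  move=> AB AB' AA; rewrite addn0.
  have [xA|nA] := boolP (x \in A).
    rewrite (mem_set (AB _ (set_mem xA))) memNset // => xA'.
    by rewrite -[False]/(set0 x) -AA; split => //; exact: set_mem.
  have [xA|//] := boolP (x \in A').
  by rewrite (mem_set (AB' _ (set_mem xA))).
move=> sE sE' dE sO sO' dO d1 d2 he; split=> [x|y|x Dx tx|y Dy ty|] /=; try exact: sub.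
- have [h|h] := d1 x (conj Dx tx); [exists c|exists d] => //; rewrite !inE eqxx ?orbT //.
- have [h|h] := d2 y (conj Dy ty); [exists c|exists d] => //; rewrite !inE eqxx ?orbT //.
- by rewrite big_cons big_seq1.
Qed.

Lemma refines_flatten D1 D2 L t (s : T -> seq T) :
  refines D1 D2 L t -> (forall c, c \in L -> refines D1 D2 (s c) c) ->
  refines D1 D2 (flatten (map s L)) t.
Proof.
move=> [h1 h2 h3 h4 h5] hs; split.
- move=> x; apply: leq_trans (h1 x); rewrite count_flatten -map_comp.
  elim: L hs {h1 h2 h3 h4 h5} => //= c L IH hs.
  apply: leq_add; first by have [] := hs c (mem_head _ _).
  by apply: IH => d dL; apply: hs; rewrite inE dL orbT.
- move=> x; apply: leq_trans (h2 x); rewrite count_flatten -map_comp.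
  elim: L hs {h1 h2 h3 h4 h5} => //= c L IH hs.
  apply: leq_add; first by have [] := hs c (mem_head _ _).
  by apply: IH => d dL; apply: hs; rewrite inE dL orbT.
- move=> x Dx /(h3 x Dx) [c cL] /((let: And5 _ _ k _ _ := hs c cL in k) x Dx) [d dc dx].
  by exists d => //; apply/flattenP; exists (s c) => //; apply/mapP; exists c.
- move=> x Dx /(h4 x Dx) [c cL] /((let: And5 _ _ _ k _ := hs c cL in k) x Dx) [d dc dx].
  by exists d => //; apply/flattenP; exists (s c) => //; apply/mapP; exists c.
apply: le_trans h5; rewrite big_flatten big_map !big_seq.
by apply: ler_sum => c /hs [].
Qed.

Lemma refines_all D1 D2 L t (P : T -> T -> Prop) :
  refines D1 D2 L t ->
  (forall c, c \in L -> exists L', refines D1 D2 L' c /\ forall d, d \in L' -> P c d) ->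
  exists L', refines D1 D2 L' t /\ forall d, d \in L' -> exists2 c, c \in L & P c d.
Proof.
move=> rL h.
have /choice [s sP] : forall c, exists L', c \in L ->
    refines D1 D2 L' c /\ forall d, d \in L' -> P c d.
  by move=> c; have [/h [L' ?]|] := boolP (c \in L); [exists L'|exists [::]].
exists (flatten (map s L)); split.
  by apply: refines_flatten => // c /sP [].
move=> d /flattenP [_ /mapP [c cL ->] dc]; exists c => //.
by have [_] := sP c cL; apply.
Qed.

Lemma refinement_tree D1 D2 (P : nat -> T -> Prop) (Q : nat -> T -> T -> Prop) t :
  P 0%N t ->
  (forall n c, P n c -> exists L, refines D1 D2 L c /\
     forall d, d \in L -> P n.+1 d /\ Q n c d) ->
  exists st : nat -> seq T, [/\ forall n, refines D1 D2 (st n) t,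
     forall n c, c \in st n -> P n c &
     forall n d, d \in st n.+1 -> exists c, [/\ c \in st n, Q n c d, E d `<=` E c & O d `<=` O c]].
Proof.
move=> P0 step.
have /choice [s sP] : forall nc : nat * T, exists L, P nc.1 nc.2 ->
    refines D1 D2 L nc.2 /\ forall d, d \in L -> P nc.1.+1 d /\ Q nc.1 nc.2 d.
  move=> [n c]; have [Pc|] := pselect (P n c); last by exists [::].
  by have [L ?] := step n c Pc; exists L.
pose st := fix st n := if n is k.+1 then flatten (map (fun c => s (k, c)) (st k)) else [:: t].
have stP n c : c \in st n -> P n c.
  elim: n c => [c|n IH c] /=; first by rewrite inE => /eqP ->.
  move=> /flattenP [_ /mapP [d /IH Pd ->] cd].
  by have [_ /(_ c cd) []] := sP (n, d) Pd.
exists st; split => // [n|n d /= /flattenP [_ /mapP [c cn ->] dc]].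
  elim: n => [|n IH]; first exact: refines_self.
  apply: refines_flatten => // c cn; exact: (sP (n, c) (stP _ _ cn)).1.
have [rc /(_ d dc) [_ q]] := sP (n, c) (stP _ _ cn).
exists c; split=> //; [exact: refines_subE rc dc|exact: refines_subO rc dc].
Qed.

Lemma count_le1 (a : pred T) L c d : (count a L <= 1)%N ->
  c \in L -> d \in L -> a c -> a d -> c = d.
Proof.
have none L' b : (count a L' <= 0)%N -> b \in L' -> a b -> False.
  by rewrite leqNgt -has_count => /hasPn h /h /negP.
elim: L => // b L IH /=; rewrite !inE.
have [ab|nab] := boolP (a b); last first.
  rewrite add0n => h /orP [/eqP ->|cL] /orP [/eqP ->|dL] // ac ad; last exact: IH.
  - by rewrite ac in nab.
  - by rewrite ad in nab.
rewrite add1n ltnS => h /orP [/eqP ->|cL] /orP [/eqP ->|dL] // ac ad.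
- by case: (none _ _ h dL ad).
- by case: (none _ _ h cL ac).
- by case: (none _ _ h cL ac).
Qed.

Lemma refines_uniqE D1 D2 L t c d x : refines D1 D2 L t -> c \in L -> d \in L ->
  E c x -> E d x -> c = d.
Proof.
move=> [h _ _ _ _] cL dL cx dx; apply: (count_le1 (a := fun c => x \in E c) _ cL dL); 
  rewrite ?in_setE //.
by apply: leq_trans (h x) _; case: (_ \in _).
Qed.

Lemma refines_uniqO D1 D2 L t c d x : refines D1 D2 L t -> c \in L -> d \in L ->
  O c x -> O d x -> c = d.
Proof.
move=> [_ h _ _ _] cL dL cx dx; apply: (count_le1 (a := fun c => x \in O c) _ cL dL); 
  rewrite ?in_setE //.
by apply: leq_trans (h x) _; case: (_ \in _).
Qed.

End Refinement.

Section Limit.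
Variables (X : topologicalType) (phi : X -> nat -> bool) (T : choiceType).
Hypothesis cod : coding phi.
Variables (E O : T -> set X) (st : nat -> seq T).

(** Two nested families of small closed sets with the same tree of indices. A point on
the left and a point on the right correspond when they follow the same branch. *)
Definition scheme :=
  [/\ forall n c, c \in st n -> [/\ closed (E c), closed (O c), small phi n (E c) & small phi n (O c)],
      forall n c d x, c \in st n -> d \in st n -> E c x -> E d x -> c = d,
      forall n c d x, c \in st n -> d \in st n -> O c x -> O d x -> c = d &
      forall n d, d \in st n.+1 -> exists c, [/\ c \in st n, E d `<=` E c & O d `<=` O c]].

Definition limit (x y : X) := forall n, exists2 c, c \in st n & E c x /\ O c y.

Hypothesis sch : scheme.

Lemma branch x : (forall n, exists2 c, c \in st n & E c x) -> exists c : nat -> T,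
  [/\ forall n, c n \in st n, forall n, E (c n) x,
      forall n, E (c n.+1) `<=` E (c n) & forall n, O (c n.+1) `<=` O (c n)].
Proof.
move=> h; have [c cP] := choice (fun n => (let: ex_intro2 c a b := h n in
  ex_intro _ c (conj a b)) : exists c, c \in st n /\ E c x).
have [s1 s2 s3 s4] := sch.
have up n : E (c n.+1) `<=` E (c n) /\ O (c n.+1) `<=` O (c n).
  have [cn Ecn] := cP n; have [cn1 Ecn1] := cP n.+1.
  have [d [dn Ed Od]] := s4 _ _ cn1.
  by rewrite (s2 n (c n) d x cn dn Ecn (Ed _ Ecn1)).
by exists c; split=> n; [case: (cP n)|case: (cP n)|case: (up n)|case: (up n)].
Qed.

Lemma limit_total x : (forall n c, c \in st n -> O c !=set0) ->
  (forall n, exists2 c, c \in st n & E c x) -> exists y, limit x y.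
Proof.
move=> O0 /branch [c [cn Ex _ Od]]; have [s1 s2 s3 s4] := sch.
have [n|//|n|y yO] := @nested_nonempty _ _ cod (fun n => O (c n)).
- by have [] := s1 _ _ (cn n).
- exact: O0 (cn n).
by exists y => n; exists (c n).
Qed.

Lemma limit_fun x y z : limit x y -> limit x z -> y = z.
Proof.
move=> hy hz; apply: (agree_eq cod) => n; have [s1 s2 s3 s4] := sch.
have [c cn [cx cy]] := hy n; have [d dn [dx dz]] := hz n.
have [_ _ _ h] := s1 _ _ cn; apply: h => //.
by rewrite (s2 n c d x).
Qed.

Lemma limit_at n x y c : limit x y -> c \in st n -> E c x -> O c y.
Proof.
move=> h cn cx; have [s1 s2 s3 s4] := sch.
by have [d dn [dx dy]] := h n; rewrite (s2 n c d x).
Qed.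

(** For [y] in the closure, at every level some node contains [y] on the right and meets [A]
on the left; these nodes form one branch, and compactness gives a point of [A] on it. *)
Lemma limit_closed A : closed A -> closed [set y | exists2 x, A x & limit x y].
Proof.
move=> cA y yc; have [s1 s2 s3 s4] := sch.
have pieces n : exists c, [/\ c \in st n, O c y & (A `&` E c) !=set0].
  have clU : closed (\big[setU/set0]_(c <- [seq c <- st n | `[< A `&` E c !=set0 >]]) O c).
    apply: closed_bigsetU => c; rewrite mem_filter => /andP [_ cn].
    by have [] := s1 _ _ cn.
  have : closure (\big[setU/set0]_(c <- [seq c <- st n | `[< A `&` E c !=set0 >]]) O c) y.
    apply: closure_subset yc => z [x Ax h]; have [c cn [cx cz]] := h n.
    rewrite -bigcup_seq; exists c => //=; rewrite mem_filter cn andbT.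
    by apply/asboolP; exists x.
  rewrite -(closure_id _).1 // -bigcup_seq => -[c /=].
  by rewrite mem_filter => /andP [/asboolP Ac cn] cy; exists c.
have [c cP] := choice pieces.
have up n : E (c n.+1) `<=` E (c n).
  have [cn Ocn _] := cP n; have [cn1 Ocn1 _] := cP n.+1.
  have [d [dn Ed Od]] := s4 _ _ cn1.
  by rewrite (s3 n (c n) d y cn dn Ocn (Od _ Ocn1)).
have [n|n|n|x xF] := @nested_nonempty _ _ cod (fun n => A `&` E (c n)).
- by apply: closedI => //; have [cn _ _] := cP n; have [] := s1 _ _ cn.
- by apply: setIS; exact: up.
- by have [] := cP n.
exists x; first by have [] := xF 0%N.
by move=> n; exists (c n); have [? ? _] := cP n => //; split => //; have [] := xF n.
Qed.

End Limit.

Lemma scheme_sym (X : topologicalType) (phi : X -> nat -> bool) (T : choiceType)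
  (E O : T -> set X) st : scheme phi E O st -> scheme phi O E st.
Proof.
move=> [s1 s2 s3 s4]; split => // [n c /s1 []//|n d /s4 [c [? ? ?]]].
by exists c.
Qed.

Lemma limit_sym (X : topologicalType) (T : choiceType) (E O : T -> set X) st x y :
  limit E O st x y -> limit O E st y x.
Proof. by move=> h n; have [c cn [? ?]] := h n; exists c. Qed.

(** * Extending partial homeomorphisms *)

Lemma preimage_Borel (X : ptopologicalType) (g : X -> X) (B : set X) :
  continuous g -> measurable (B : set (borelType X)) ->
  measurable (g @^-1` B : set (borelType X)).
Proof.
move=> cg; pose G := [set B : set X | measurable (g @^-1` B : set (borelType X))].
rewrite -/(G B); suff : <<s @open X >> `<=` G by apply.
apply: smallest_sub; last first.
  by move=> U oU; apply: Bor_open; apply: open_comp => // x _; exact: cg.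
split=> [|A GA|A GA]; rewrite /G /=.
- by rewrite preimage_set0; exact: measurable0.
- by rewrite setTD preimage_setC; exact: measurableC.
- by rewrite preimage_bigcup; apply: bigcupT_measurable.
Qed.

Section Extension.
Variables (R : realType) (X : ptopologicalType).
Variable mu : {finite_measure set (borelType X) -> \bar R}.
Variable phi : X -> nat -> bool.
Hypothesis cod : coding phi.
Hypothesis cont : continuous_measure mu.
Hypothesis spos : strictly_positive mu.
Hypothesis scond : subset_condition mu.

Local Notation Bor A := (measurable (A : set (borelType X))).
Local Notation m := (m mu).

Lemma sum_m_le (T : choiceType) (E F : T -> set X) L (P : pred T) B :
  (forall x, (count (fun c => x \in E c) L <= 1)%N) ->
  (forall c, c \in L -> P c -> [/\ F c `<=` E c, F c `<=` B & Bor (F c)]) ->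
  Bor B -> \sum_(c <- L | P c) m (F c) <= m B.
Proof.
elim: L B => [|c L IH] B cnt FP BB; first by rewrite big_nil m_ge0.
have cntL x : (count (fun c => x \in E c) L <= 1)%N.
  by apply: leq_trans (cnt x); rewrite /= leq_addl.
have FPL d : d \in L -> P d -> [/\ F d `<=` E d, F d `<=` B & Bor (F d)].
  by move=> dL; apply: FP; rewrite inE dL orbT.
rewrite big_cons; case: ifP => Pc; last exact: IH.
have [cE cB Bc] := FP c (mem_head _ _) Pc.
have : \sum_(d <- L | P d) m (F d) <= m (B `\` F c).
  apply: IH => //; last exact: measurableD.
  move=> d dL Pd; have [dE dB Bd] := FPL d dL Pd; split=> // x dx; split; first exact: dB.
  move=> cx; have := cnt x; rewrite /= (mem_set (cE _ cx)) add1n ltnS leqNgt -has_count.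
  by move=> /hasPn /(_ d dL); rewrite (mem_set (dE _ dx)).
by rewrite mD //; lra.
Qed.

Lemma m_le_sum (T : choiceType) (F : T -> set X) L (P : pred T) B :
  (forall c, c \in L -> Bor (F c)) -> Bor B ->
  (forall x, B x -> exists c, [/\ c \in L, P c & F c x]) ->
  m B <= \sum_(c <- L | P c) m (F c).
Proof.
elim: L B => [|c L IH] B FB BB cov.
  by rewrite (_ : B = set0) ?m0 ?big_nil //; apply/seteqP; split=> // x /cov [d []].
have FBL d : d \in L -> Bor (F d) by move=> dL; apply: FB; rewrite inE dL orbT.
have Bc := FB c (mem_head _ _).
rewrite big_cons; case: ifP => Pc; last first.
  apply: IH => // x /cov [d [+ Pd dx]]; rewrite inE => /orP [/eqP dc|dL]; last by exists d.
  by rewrite dc Pc in Pd.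
have : m (B `\` F c) <= \sum_(d <- L | P d) m (F d).
  apply: IH => //; first exact: measurableD.
  move=> x [/cov [d [+ Pd dx]] ncx]; rewrite inE => /orP [/eqP dc|dL]; last by exists d.
  by rewrite dc in dx.
have := mDI mu BB Bc.
have : m (B `&` F c) <= m (F c) by apply: le_m => //; exact: measurableI.
lra.
Qed.

Definition img (G : X -> X -> Prop) (A : set X) : set X := [set y | exists2 x, A x & G x y].

(** Partial injections, seen from the left: the image of a clopen set is closed, and leaves
room for a clopen neighbourhood of smaller measure than the set itself. *)
Definition thin (G : X -> X -> Prop) := forall A, clopen A ->
  [/\ closed (img G A), img G A `&` img G (~` A) = set0 & A !=set0 -> m (img G A) < m A].

(** A position of the back-and-forth construction. *)
Definition matched (G : X -> X -> Prop) (p : set X * set X) :=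
  [/\ clopen p.1, clopen p.2, p.1 !=set0, m p.1 = m p.2 &
      forall x y, G x y -> (p.1 x <-> p.2 y)].

Lemma matched_sym G p : matched G p -> matched (fun y x => G x y) (p.2, p.1).
Proof.
move=> [c1 c2 n1 me h]; split => //=; last by move=> x y /h [].
apply/set0P/eqP => p0; have := m_gt0 spos c1.1 n1.
by rewrite me p0 m0 ltxx.
Qed.

Local Notation split D1 D2 := (@refines R X _ fst snd (fun=> 0) D1 D2).

Lemma eventually_thicken Y B a : closed Y -> clopen B -> Y `<=` B -> m Y < a ->
  exists n0, forall n, (n0 <= n)%N -> thicken phi n Y `<=` B /\ m (thicken phi n Y) < a.
Proof.
move=> cY cB YB Ya; have [n1 h1] := clopen_sub_closed cod cB cY YB.
have [|n2 h2] := m_thicken mu cod cY (e := a - m Y); first by rewrite subr_gt0.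
exists (maxn n1 n2) => n; rewrite geq_max => /andP [l1 l2]; split.
  by apply: subset_trans h1; exact: thicken_le.
apply: (@le_lt_trans _ _ (m (thicken phi n2 Y))); last by lra.
by apply: le_m; [apply: Bor_clopen; exact: clopen_thicken..|exact: thicken_le].
Qed.

(** One half of the back-and-forth: the parts of [G] over [A `&` U] and over [A `\` U] have
disjoint closed images, hence disjoint clopen neighbourhoods that are smaller than
[A `&` U] and [A `\` U]; these are filled up to the right measure. *)
Lemma split_matched G p U : thin G -> matched G p -> clopen U ->
  exists L, split setT setT L p /\
    forall c, c \in L -> matched G c /\ (c.1 `<=` U \/ c.1 `<=` ~` U).
Proof.
move: p => [A B] tG [/= cA cB A0 mAB h] cU.
have M : matched G (A, B) by [].
have [/eqP e1|n1] := boolP (A `&` U == set0).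
  exists [:: (A, B)]; split; first exact: refines_self.
  move=> c; rewrite inE => /eqP ->; split => //; right => x Ax Ux.
  by rewrite -[False]/(set0 x) -e1.
have [/eqP e2|n2] := boolP (A `\` U == set0).
  exists [:: (A, B)]; split; first exact: refines_self.
  move=> c; rewrite inE => /eqP ->; split => //; left => x Ax; apply: contrapT => Ux.
  by rewrite -[False]/(set0 x) -e2.
set A1 := A `&` U in n1; set A2 := A `\` U in n2.
have c1 : clopen A1 by apply: clopenI.
have c2 : clopen A2 by apply: clopen_setD.
have A12 : A1 `&` A2 = set0 by apply/seteqP; split=> x // [[_ ?] []].
have A12U : A1 `|` A2 = A.
  by apply/seteqP; split=> [x [[]|[]]//|x Ax]; case: (pselect (U x)); [left|right].
have mA : m A = m A1 + m A2.
  by rewrite -mU ?A12U //; exact: Bor_clopen.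
have [cl1 d1 s1] := tG _ c1; have [cl2 d2 s2] := tG _ c2.
have sub1 : img G A1 `<=` B by move=> y [x [Ax _] /h] [+ _]; apply.
have sub2 : img G A2 `<=` B by move=> y [x [Ax _] /h] [+ _]; apply.
have dis : img G A1 `&` img G A2 = set0.
  apply/seteqP; split=> // y [i1 [x Ax gx]]; rewrite -d1; split => //.
  by exists x => // A1x; rewrite -[False]/(set0 x) -A12.
have [n hn] := disjoint_thicken cod cl1 cl2 dis.
have [k1 hk1] := eventually_thicken cl1 cB sub1 (s1 ((set0P _).1 n1)).
have [k2 hk2] := eventually_thicken cl2 cB sub2 (s2 ((set0P _).1 n2)).
pose N := maxn n (maxn k1 k2).
have [v1 v1'] : thicken phi N (img G A1) `<=` B /\ m (thicken phi N (img G A1)) < m A1.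
  by apply: hk1; rewrite /N !leq_max leqnn !orbT.
have [v2 v2'] : thicken phi N (img G A2) `<=` B /\ m (thicken phi N (img G A2)) < m A2.
  by apply: hk2; rewrite /N !leq_max leqnn !orbT.
have dN : thicken phi N (img G A1) `&` thicken phi N (img G A2) = set0.
  apply/seteqP; split=> // y [y1 y2]; rewrite -hn; split.
    by apply: thicken_le y1; rewrite leq_maxl.
  by apply: thicken_le y2; rewrite leq_maxl.
have [B1 [cB1 VB1 BB1 dB1 mB1]] := fill scond c1 cB (clopen_thicken cod _ _)
  (clopen_thicken cod _ _) v1 v2 dN (etrans (esym mAB) mA) v1' v2'.
have mB2 : m (B `\` B1) = m A2.
  by rewrite mD //; [lra|exact: Bor_clopen..].
have y1 x y : G x y -> A1 x -> B1 y.
  by move=> g a; apply: VB1; apply: sub_thicken; exists x.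
have y2 x y : G x y -> A2 x -> ~ B1 y.
  move=> g a b; rewrite -[False]/(set0 y) -dB1; split => //.
  by apply: sub_thicken; exists x.
exists [:: (A1, B1); (A2, B `\` B1)]; split.
  apply: refines2 => //=.
  - by move=> x [].
  - by move=> x [].
  - by apply/seteqP; split=> x // [? []].
  - by rewrite A12U => x [].
  - by move=> x [_ Bx]; case: (pselect (B1 x)); [left|right].
move=> c; rewrite !inE => /orP [] /eqP ->; split.
- split => //=; first exact/set0P.
  move=> x y g; split; first exact: y1.
  move=> b; have : A x by apply/(h x y g); exact: BB1.
  by rewrite -A12U => -[//|/(y2 x y g)].
- by left=> x [].
- split => //=; [exact: clopen_setD|exact/set0P|].
  move=> x y g; split.
    by move=> a; split; [apply/(h x y g); case: a|exact: y2 g a].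
  move=> [b nb]; have : A x by apply/(h x y g).
  by rewrite -A12U => -[/(y1 x y g)|].
- by right=> x [].
Qed.

Lemma split_matched_sym G p U : thin (fun y x => G x y) -> matched G p -> clopen U ->
  exists L, split setT setT L p /\
    forall c, c \in L -> matched G c /\ (c.2 `<=` U \/ c.2 `<=` ~` U).
Proof.
move=> tG M cU; have [L [[h1 h2 h3 h4 h5] hL]] := split_matched tG (matched_sym M) cU.
exists [seq (c.2, c.1) | c <- L]; split; last first.
  move=> _ /mapP [[a b] /hL [Mc Uc] ->]; split => //; exact: (matched_sym Mc).
split.
- by move=> x; rewrite count_map; exact: h2.
- by move=> x; rewrite count_map; exact: h1.
- by move=> x Dx /(h4 x Dx) [c cL cx]; exists (c.2, c.1) => //; apply/mapP; exists c.
- by move=> x Dx /(h3 x Dx) [c cL cx]; exists (c.2, c.1) => //; apply/mapP; exists c.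
- by rewrite big1.
Qed.

Lemma small_bit n (A B : set X) : small phi n A -> B `<=` A ->
  B `<=` [set x | phi x n] \/ B `<=` ~` [set x | phi x n] -> small phi n.+1 B.
Proof.
move=> sA BA h x y Bx By; apply: agreeS; first by apply: sA; exact: BA.
case: h => h; first by rewrite (h x Bx) (h y By).
by have := h x Bx; have := h y By => /negP/negbTE -> /negP/negbTE ->.
Qed.

Lemma matched_scheme G : thin G -> thin (fun y x => G x y) ->
  exists st : nat -> seq (set X * set X),
    [/\ scheme phi fst snd st,
        forall n x, exists2 c, c \in st n & c.1 x,
        forall n y, exists2 c, c \in st n & c.2 y,
        forall n c, c \in st n -> matched G c &
        forall n x, (count (fun c => x \in c.1) (st n) <= 1)%N].
Proof.
move=> tG tG'; pose P n p := [/\ matched G p, small phi n p.1 & small phi n p.2].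
have P0 : P 0%N (setT, setT).
  by split => //; split => //=; [exact: clopenT|exact: clopenT|exists point].
have [n c [Mc s1 s2]|st [sr sP sQ]] := refinement_tree (E := fst) (O := snd)
    (e := fun=> 0 : R) (D1 := setT) (D2 := setT) (Q := fun _ _ _ => True) P0.
  have [L [rL hL]] := split_matched tG Mc (cod_bit cod n).
  have [c' c'L|L' [rL' hL']] := refines_all (P := fun c d => [/\ matched G d,
      d.2 `<=` [set x | phi x n] \/ d.2 `<=` ~` [set x | phi x n] & d.1 `<=` c.1]) rL.
    have [Mc' _] := hL _ c'L.
    have [L2 [r2 h2]] := split_matched_sym tG' Mc' (cod_bit cod n).
    exists L2; split=> // d dL2; have [? ?] := h2 d dL2; split => //.
    exact: refines_subE r2 dL2.
  exists L'; split=> // d dL'; split => //.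
  have [c' c'L [Md d2 d1]] := hL' d dL'; have [_ c'1] := hL _ c'L.
  split => //.
    apply: small_bit s1 _ _; first exact: refines_subE rL' dL'.
    by case: c'1 => h; [left|right]; exact: subset_trans d1 h.
  by apply: small_bit s2 _ d2; exact: refines_subO rL' dL'.
exists st; split => //.
- split.
  + by move=> n c /sP [[[_ ?] [_ ?]] ? ?].
  + by move=> n c d x cn dn; exact: refines_uniqE (sr n) cn dn.
  + by move=> n c d x cn dn; exact: refines_uniqO (sr n) cn dn.
  + by move=> n d /sQ [c [? _ ? ?]]; exists c.
- by move=> n x; have [_ _ + _ _] := sr n; apply.
- by move=> n x; have [_ _ _ + _] := sr n; apply.
- by move=> n c /sP [].
- by move=> n x; have [h _ _ _ _] := sr n; apply: leq_trans (h x) _; case: (_ \in _).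
Qed.

Lemma limit_continuous (T : choiceType) (E O : T -> set X) st (h : X -> X) :
  scheme phi E O st -> (forall n c, c \in st n -> open (E c)) ->
  (forall x, limit E O st x (h x)) -> continuous h.
Proof.
move=> sch oE lh x U; rewrite {1}nbhsE => -[V [oV Vx] VU].
have [n nV] := open_thicken1 cod oV Vx.
have [c cn [cx cy]] := lh x n; have [s1 _ _ _] := sch; have [_ _ _ sO] := s1 _ _ cn.
rewrite /= nbhsE; exists (E c); first by split => //; exact: oE cn.
move=> y Ey /=; apply: VU; apply: nV; rewrite thicken1.
by apply: sO => //; exact: (limit_at sch (lh y) cn Ey).
Qed.

Lemma homeo_open (h g : X -> X) : cancel h g -> cancel g h -> continuous g ->
  forall A, h @` A = g @^-1` A.
Proof.
move=> hg gh cg A; apply/seteqP; split=> [_ [x Ax <-]|y Ay]; first by rewrite /= hg.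
by exists (g y).
Qed.

(** Preservation of the measure passes from clopen sets to closed sets by outer
approximation, and from closed sets to Borel sets by regularity. *)
Lemma preserving_of_clopen (h g : X -> X) :
  cancel h g -> cancel g h -> continuous h -> continuous g ->
  (forall A, clopen A -> m (h @` A) = m A) ->
  measure_preserving_homeomorphism mu h.
Proof.
move=> hg gh ch cg hA; split; first by exists g.
have imh := homeo_open hg gh cg; have img := homeo_open gh hg ch.
have clo (f : X -> X) A : continuous f -> closed A -> closed (f @^-1` A).
  by move=> cf cA; apply: preimage_closed => // x _; exact: cf.
have clp (f : X -> X) A : continuous f -> clopen A -> clopen (f @^-1` A).
  move=> cf [oA cA]; split; last exact: clo.
  by apply: open_comp => // x _; exact: cf.
have le_closed (f f' : X -> X) : continuous f' -> (forall A, f @` A = f' @^-1` A) ->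
    (forall A, clopen A -> m (f @` A) = m A) -> forall F, closed F -> m (f @` F) <= m F.
  move=> cf' imf fA F cF; apply/ler_addgt0Pr => e e0.
  have [n hn] := m_thicken mu cod cF e0; apply: le_trans (ltW hn).
  rewrite -(fA _ (clopen_thicken cod n F)); apply: le_m.
  - by rewrite imf; apply: Bor_closed; exact: clo.
  - by rewrite imf; apply: Bor_clopen; apply: clp => //; exact: clopen_thicken.
  - by apply: image_subset; exact: sub_thicken.
have gA A : clopen A -> m (g @` A) = m A.
  move=> cA; rewrite -(hA (g @` A)); last by rewrite img; exact: clp.
  by congr m; apply/seteqP; split=> [_ [_ [x Ax <-] <-]|x Ax]; [rewrite gh|
    exists (g x); [exists x|rewrite gh]].
have Bh B : Bor B -> Bor (h @` B) by move=> BB; rewrite imh; exact: preimage_Borel.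
have ge_closed F : closed F -> m F <= m (h @` F).
  move=> cF; apply: le_trans (le_closed g h ch img gA _ _); last by rewrite imh; exact: clo.
  apply: le_m; [exact: Bor_closed|
    by rewrite img; apply: Bor_closed; apply: (clo) => //; rewrite imh; exact: clo|].
  by move=> x Fx; exists (h x); [exists x|rewrite hg].
have ge B : Bor B -> m B <= m (h @` B).
  move=> BB; apply/ler_addgt0Pr => e e0.
  have [[F U] /= [cF oU FB BU hm]] := regular mu cod BB e0.
  have h1 : m (h @` F) <= m (h @` B).
    by apply: le_m; [apply: Bh; exact: Bor_closed|exact: Bh|exact: image_subset].
  have h2 : m B <= m U by apply: le_m => //; exact: Bor_open.
  have := ge_closed F cF; move: hm; rewrite mD; [lra|exact: Bor_open|exact: Bor_closed|].
  exact: subset_trans FB BU.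
move=> B BB; have BhB := Bh B BB; rewrite !(mE mu) //; congr EFin.
apply/eqP; rewrite eq_le ge // andbT.
have := ge (~` B) (measurableC BB).
have -> : h @` (~` B) = ~` (h @` B) by rewrite !imh.
have C A : Bor A -> m (~` A) = m setT - m A by move=> BA; rewrite -setTD mD.
by rewrite !C //; lra.
Qed.

(** The hypotheses are symmetric in the two sides, so clopen sets are split alternately on
the left and on the right; the limit is a bijection, and it extends [G] because every
position is compatible with [G]. *)
Lemma extension G : thin G -> thin (fun y x => G x y) ->
  exists h, measure_preserving_homeomorphism mu h /\ forall x y, G x y -> h x = y.
Proof.
move=> tG tG'; have [st [sch covE covO Mst cnt]] := matched_scheme tG tG'.
have sch' := scheme_sym sch.
have nO n c : c \in st n -> c.2 !=set0.
  by move=> /Mst M; have [_ _ ? _ _] := matched_sym M.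
have nE n c : c \in st n -> c.1 !=set0 by move=> /Mst [].
have [h hP] := choice (fun x => limit_total cod sch nO (fun n => covE n x)).
have [g gP] := choice (fun y => limit_total cod sch' nE (fun n => covO n y)).
have hg : cancel h g.
  by move=> x; exact: (limit_fun cod sch' (gP (h x)) (limit_sym (hP x))).
have gh : cancel g h.
  by move=> x; exact: (limit_fun cod sch (hP (g x)) (limit_sym (gP x))).
have ch : continuous h.
  by apply: (limit_continuous sch _ hP) => n c /Mst [[]].
have cg : continuous g.
  by apply: (limit_continuous sch' _ gP) => n c /Mst [_ []].
exists h; split; last first.
  move=> x y g0; apply: (limit_fun cod sch (hP x)) => n.
  have [c cn cx] := covE n x; exists c => //; split => //.
  by have [_ _ _ _ /(_ x y g0) [xy _]] := Mst _ _ cn; exact: xy.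
apply: (preserving_of_clopen hg gh ch cg).
have Bh A : clopen A -> Bor (h @` A).
  by move=> cA; rewrite (homeo_open hg gh cg); apply: preimage_Borel => //; exact: Bor_clopen.
have le A : clopen A -> m (h @` A) <= m A.
  move=> cA; have [p pA] := clopen_level cod cA.
  pose P := fun c : set X * set X => `[< c.1 `<=` A >].
  apply: (@le_trans _ _ (\sum_(c <- st p | P c) m c.2)).
    apply: m_le_sum; [by move=> c /Mst [_ /Bor_clopen]|exact: Bh|].
    move=> _ [x Ax <-]; have [c cp [cx cy]] := hP x p.
    exists c; split => //; apply/asboolP => z cz; rewrite -pA.
    by exists x => //; have [s1 _ _ _] := sch; have [_ _ sm _] := s1 _ _ cp; exact: sm.
  have -> : \sum_(c <- st p | P c) m c.2 = \sum_(c <- st p | P c) m c.1.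
    rewrite big_seq_cond [RHS]big_seq_cond.
    by apply: eq_bigr => c /andP [/Mst [_ _ _ -> _] _].
  apply: sum_m_le (cnt p) _ _; last exact: Bor_clopen.
  by move=> c cp /asboolP cA'; split => //; have [/Bor_clopen] := Mst _ _ cp.
move=> A cA; apply/eqP; rewrite eq_le le //=.
have cA' : clopen (~` A) by apply: clopen_setC.
have := le _ cA'.
have -> : h @` (~` A) = ~` (h @` A) by rewrite !(homeo_open hg gh cg).
have C B : Bor B -> m (~` B) = m setT - m B by move=> BA; rewrite -setTD mD.
have B1 := Bh A cA; have B2 := Bor_clopen cA.
by rewrite !C //; lra.
Qed.

End Extension.

(** * Splitting and reserving traces of open sets *)

Section Embedding.
Variables (R : realType) (X : ptopologicalType).
Variable mu : {finite_measure set (borelType X) -> \bar R}.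
Variable phi : X -> nat -> bool.
Hypothesis cod : coding phi.
Hypothesis cont : continuous_measure mu.
Hypothesis spos : strictly_positive mu.

Local Notation Bor A := (measurable (A : set (borelType X))).
Local Notation m := (m mu).

Variables (M : metricType R) (f : M -> X) (Q : set M).
Hypothesis cf : continuous f.

Definition trace (V : set M) : set X := f @` (V `&` Q).
Definition cut (V : set M) (O : set X) : set M := V `&` f @^-1` O.

Hypothesis branching : forall V x, open V -> V `&` Q !=set0 -> exists2 y, trace V y & y <> x.

(** A set of measure [z] can be sent into the closure of [trace V] with room to spare. The
case [z = 0] is separate because null sets are also embedded into null closures. *)
Definition fits (z : R) (V : set M) :=
  [/\ open V, V `&` Q !=set0 & z = 0 \/ z < m (closure (trace V))].

Lemma cut_open V O : open V -> clopen O -> open (cut V O).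
Proof.
by move=> oV [oO _]; apply: openI => //; apply: open_comp => // x _; exact: cf.
Qed.

Lemma cut_sub V O : cut V O `<=` V. Proof. by move=> x []. Qed.

Lemma trace_subset V W : V `<=` W -> trace V `<=` trace W.
Proof. by move=> VW _ [x [/VW Wx Qx] <-]; exists x. Qed.

Lemma trace_cut V O : trace (cut V O) = trace V `&` O.
Proof.
apply/seteqP; split=> [_ [x [[Vx Ox] Qx] <-]|_ [[x [Vx Qx] <-] Ox]].
  by split => //; exists x.
by exists x.
Qed.

Lemma closureI_clopen (Y O : set X) : clopen O -> closure (Y `&` O) = closure Y `&` O.
Proof.
move=> [oO cO]; apply/seteqP; split=> [y h|y [h Oy] U Uy].
  split; first by apply: closure_subset h => z [].
  by apply: cO; apply: closure_subset h => z [].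
have [z [Yz [Oz Uz]]] := h _ (filterI (open_nbhs_nbhs (conj oO Oy)) Uy).
by exists z.
Qed.

Lemma Bor_closure Y : Bor (closure Y).
Proof. by apply: Bor_closed; exact: closed_closure. Qed.

Lemma nonempty_of_pos V : 0 < m (closure (trace V)) -> V `&` Q !=set0.
Proof.
move=> h; apply/set0P/eqP => e; move: h; rewrite /trace e image_set0 closure0 m0.
by rewrite ltxx.
Qed.

Lemma fits_cut (z : R) V O : open V -> clopen O -> 0 <= z ->
  z < m (closure (trace V) `&` O) -> fits z (cut V O).
Proof.
move=> oV cO z0; rewrite -closureI_clopen // -trace_cut => h; split; last by right.
  exact: cut_open.
by apply: nonempty_of_pos; lra.
Qed.

Lemma fits_cut0 V O p : open V -> clopen O -> V p -> Q p -> O (f p) -> fits 0 (cut V O).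
Proof. by move=> oV cO Vp Qp Op; split; [exact: cut_open|exists p|left]. Qed.

Lemma fits_le (z z' : R) V : 0 <= z' -> z' <= z -> fits z V -> fits z' V.
Proof.
move=> z0 zz [oV nV [h|h]]; split => //; first by left; lra.
by right; lra.
Qed.

Lemma fits_lt (z : R) V O : 0 <= z -> fits z V -> clopen O -> trace V `<=` O -> z < m O.
Proof.
move=> z0 [oV [p [Vp Qp]] [->|h]] cO VO.
  by apply: m_gt0 => //; [exact: cO.1|exists (f p); apply: VO; exists p].
apply: lt_le_trans h _; apply: le_m; [exact: Bor_closure|exact: Bor_clopen|].
by rewrite [X in _ `<=` X](closure_id O).1; [exact: closure_subset|exact: cO.2].
Qed.

Lemma measure_cut V O : clopen O -> m (closure (trace V)) =
  m (closure (trace V) `&` O) + m (closure (trace V) `&` ~` O).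
Proof.
by move=> cO; rewrite (mDI mu (Bor_closure (trace V)) (Bor_clopen cO)) setDE addrC.
Qed.

(** A set split into parts of measures [z0] and [z1] is followed by a clopen splitting of the
target; for null sets this uses that the trace has two distinct points. *)
Lemma split_target (z0 z1 : R) V : 0 <= z0 -> 0 <= z1 -> fits (z0 + z1) V ->
  exists O, [/\ clopen O, fits z0 (cut V O) & fits z1 (cut V (~` O))].
Proof.
move=> h0 h1 [oV [p [Vp Qp]] [z|z]].
  have [z00 z10] : z0 = 0 /\ z1 = 0 by split; lra.
  have [_ [q [Vq Qq] <-] qp] := branching (f p) oV (ex_intro _ p (conj Vp Qp)).
  have oU : open (~` [set f q]) by apply: closed_openC; exact: (closed1 cod).
  have [n hn] := open_thicken1 cod oU (fun e => qp (esym e)).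
  exists (thicken phi n [set f p]); split; first exact: clopen_thicken.
    by rewrite z00; apply: fits_cut0 Vp Qp _ => //; [exact: clopen_thicken|exact: sub_thicken].
  rewrite z10; apply: fits_cut0 Vq Qq _ => //; first by apply: clopen_setC; exact: clopen_thicken.
  by move=> /hn; apply.
have [|||O [cO l1 l2]] := @m_between _ _ mu phi cod cont (closure (trace V)) z0
  ((m (closure (trace V)) - (z0 + z1)) / 2) (Bor_closure _); [by []|lra|lra|].
exists O; split => //; first exact: fits_cut.
apply: fits_cut => //; first exact: clopen_setC.
by have := measure_cut V cO; lra.
Qed.

(** Conversely, a clopen splitting of the target is followed by one of the source; a part of
the target that is null or empty receives nothing. *)
Lemma split_source Z V P : closed Z -> fits (m Z) V -> clopen P ->
  exists U, [/\ clopen U, Z `&` U = set0 \/ fits (m (Z `&` U)) (cut V P) &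
                Z `\` U = set0 \/ fits (m (Z `\` U)) (cut V (~` P))].
Proof.
move=> cZ [oV [p [Vp Qp]] hz] cP; have cP' := clopen_setC cP; have BZ := Bor_closed cZ.
have all_left : fits (m Z) (cut V P) -> exists U, [/\ clopen U,
    Z `&` U = set0 \/ fits (m (Z `&` U)) (cut V P) &
    Z `\` U = set0 \/ fits (m (Z `\` U)) (cut V (~` P))].
  move=> h; exists setT; split; first exact: clopenT.
    by right; rewrite setIT.
  by left; rewrite setDT.
have all_right : fits (m Z) (cut V (~` P)) -> exists U, [/\ clopen U,
    Z `&` U = set0 \/ fits (m (Z `&` U)) (cut V P) &
    Z `\` U = set0 \/ fits (m (Z `\` U)) (cut V (~` P))].
  move=> h; exists set0; split; first exact: clopen0.
    by left; rewrite setI0.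
  by right; rewrite setD0.
case: hz => hz.
  have [Pp|nPp] := pselect (P (f p)).
    by apply: all_left; rewrite hz; exact: fits_cut0 Vp Qp Pp.
  by apply: all_right; rewrite hz; exact: fits_cut0 Vp Qp nPp.
have mc := measure_cut V cP; have z0 := m_ge0 mu Z.
(* The measure of [Z `&` U] has to lie between [m Z - k1] and [k0]. *)
set k0 := m (_ `&` P) in mc; set k1 := m (_ `&` ~` P) in mc.
have [l0|g0] := ltP (m Z) k0; first by apply: all_left; exact: fits_cut.
have [l1|g1] := ltP (m Z) k1; first by apply: all_right; exact: fits_cut.
have [|||U [cU l1 l2]] := @m_between _ _ mu phi cod cont Z (m Z - k1)
  ((k0 + k1 - m Z) / 2) BZ; [lra|lra|lra|].
have zz := mDI mu BZ (Bor_clopen cU).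
have := m_ge0 mu (Z `\` U); have := m_ge0 mu (Z `&` U) => ? ?.
by exists U; split => //; right; apply: fits_cut => //; rewrite -/k0 -/k1; lra.
Qed.

Lemma small_thicken1 n x : small phi n (thicken phi n [set x]).
Proof.
rewrite thicken1 => y z /= a b; apply: agree_trans a _; exact: agree_sym.
Qed.

Lemma shrink_target (z : R) V (e : R) : 0 <= z -> fits z V -> 0 < e ->
  exists O, [/\ clopen O, m O < z + e & fits z (cut V O)].
Proof.
move=> z0 [oV [p [Vp Qp]] [->|hz]] e0.
  have [n hn] := m_small cod cont e0.
  exists (thicken phi n [set f p]); split; first exact: clopen_thicken.
    rewrite add0r; apply: hn; first exact: small_thicken1.
    by apply: Bor_clopen; exact: clopen_thicken.
  by apply: fits_cut0 Vp Qp _ => //; [exact: clopen_thicken|exact: sub_thicken].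
set K := closure (trace V) in hz *.
have BK : Bor K by exact: Bor_closure.
have [|||O [cO l1 l2]] := @m_between _ _ mu phi cod cont K z (e / 4) BK; [by []|by []|lra|].
have [|n hn] := m_thicken mu cod (@closed_closure _ (trace V)) (e := e / 2); first lra.
have cN := clopen_thicken cod n K; have KN : K `<=` thicken phi n K by exact: sub_thicken.
have cON : clopen (O `&` thicken phi n K) by apply: clopenI.
exists (O `&` thicken phi n K); split => //; last first.
  apply: fits_cut => //; rewrite -/K setIA [K `&` O]setIC -setIA (setIidl KN).
  by rewrite setIC.
rewrite (mDI mu (Bor_clopen cON) BK).
have -> : O `&` thicken phi n K `&` K = K `&` O by rewrite -setIA (setIidr KN) setIC.
have h1 : m ((O `&` thicken phi n K) `\` K) <= m (thicken phi n K `\` K).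
  apply: le_m; [by apply: measurableD => //; exact: Bor_clopen..|].
  by move=> x [[]].
by move: h1; rewrite [m (thicken _ _ _ `\` _)]mD //; [rewrite -/K in hn; lra|exact: Bor_clopen].
Qed.

(** A small open set [W] is put aside together with a clopen region [P] of the target, without
spoiling the fit of what goes to the rest of the target. *)
Lemma reserve (z : R) V (d : R) : 0 <= z -> fits z V -> 0 < d -> exists PW : set X * set M,
  [/\ clopen PW.1, fits z (cut V (~` PW.1)), fits 0 PW.2, PW.2 `<=` cut V PW.1 &
      exists c, PW.2 `<=` ball c d].
Proof.
move=> z0 fz d0; have [|||O [cO [oW [p [Wp Qp]] _] f1]] := @split_target 0 z V;
  [by []|by []|by rewrite add0r|].
exists (O, cut V O `&` (ball p d)°); split => //=.
- split; [by apply: openI => //; exact: open_interior| |by left].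
  by exists p; split => //; split => //; apply: nbhsx_ballx.
- by exists p => x [_ /interior_subset].
Qed.

End Embedding.

(** * Splitting a closed set along a continuous map *)

(** A piece of a closed set on the left, to be mapped into [iO] along the open set [iV]
of the metric space. *)
Record item (R X M : Type) := Item { iF : set X; iO : set X; iV : set M; ie : R }.

HB.instance Definition _ (R X M : Type) := gen_eqMixin (item R X M).
HB.instance Definition _ (R X M : Type) := gen_choiceMixin (item R X M).

Section Splitting.
Variables (R : realType) (X : ptopologicalType).
Variable mu : {finite_measure set (borelType X) -> \bar R}.
Variable phi : X -> nat -> bool.
Hypothesis cod : coding phi.
Hypothesis cont : continuous_measure mu.
Hypothesis spos : strictly_positive mu.

Local Notation Bor A := (measurable (A : set (borelType X))).
Local Notation m := (m mu).

Variables (M : metricType R) (f : M -> X) (Q : set M).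
Hypothesis cf : continuous f.

Local Notation fits := (fits mu f Q).
Local Notation trace := (trace f Q).
Local Notation cut := (cut f).

Hypothesis branching : forall V x, open V -> V `&` Q !=set0 -> exists2 y, trace V y & y <> x.

Variable Z : set X.
Hypothesis cZ : closed Z.

Definition fitted n n' (t : item R X M) :=
  [/\ clopen (iF t) /\ small phi n (iF t), clopen (iO t) /\ small phi n' (iO t),
      fits (m (Z `&` iF t)) (iV t), trace (iV t) `<=` iO t & 0 < ie t].

Local Notation refines := (@refines R X _ (@iF R X M) (@iO R X M) (@ie R X M) Z set0).

Lemma trace_cutS V O P : trace V `<=` O -> trace (cut V P) `<=` O `&` P.
Proof. by move=> VO; rewrite trace_cut => y [/VO]. Qed.

Lemma BorZ F : clopen F -> Bor (Z `&` F).
Proof. by move=> cF; apply: measurableI; [exact: Bor_closed|exact: Bor_clopen]. Qed.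

Lemma halves n F : small phi n F -> let b := [set x | phi x n] in
  small phi n.+1 (F `&` b) /\ small phi n.+1 (F `\` b).
Proof.
by move=> sF b; split; apply: small_bit sF _ _;
  [move=> x []|left=> x []|move=> x []|right=> x []].
Qed.

Lemma clopen_halves n F : clopen F -> let b := [set x | phi x n] in
  clopen (F `&` b) /\ clopen (F `\` b).
Proof.
by move=> cF b; split; [apply: clopenI|apply: clopen_setD] => //; exact: cod_bit.
Qed.

Lemma halves_disjoint (T : Type) (F b : set T) : (F `&` b) `&` (F `\` b) = set0.
Proof. by apply/seteqP; split=> x // [[_ ?] []]. Qed.

Lemma halves_cover (T : Type) (F b : set T) : F `<=` (F `&` b) `|` (F `\` b).
Proof. by move=> x Fx; case: (pselect (b x)); [left|right]. Qed.

Lemma m_halves F b : clopen F -> clopen b ->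
  m (Z `&` (F `&` b)) + m (Z `&` (F `\` b)) = m (Z `&` F).
Proof.
move=> cF cb; rewrite [RHS](mDI mu (BorZ cF) (Bor_clopen cb)) addrC.
by rewrite (setIDA Z F b) (setIA Z F b).
Qed.

Lemma fit_left n n' t : fitted n n' t ->
  exists L, refines L t /\ forall c, c \in L -> fitted n.+1 n' c /\ iV c `<=` iV t.
Proof.
move=> [[cF sF] [cO sO] ft tO e0]; set b := [set x | phi x n].
have cb : clopen b by exact: cod_bit.
have [s0 s1] := halves sF; have [c0 c1] := clopen_halves n cF.
have := ft; rewrite -(m_halves cF cb) => /(split_target cod cont cf branching (m_ge0 _ _) (m_ge0 _ _)).
move=> [P [cP f0 f1]].
have e2 : 0 < ie t / 2 by rewrite divr_gt0.
exists [:: Item (iF t `&` b) (iO t `&` P) (cut (iV t) P) (ie t / 2);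
           Item (iF t `\` b) (iO t `\` P) (cut (iV t) (~` P)) (ie t / 2)]; split.
  apply: refines2 => /=; try by move=> x [].
  - exact: halves_disjoint.
  - exact: halves_disjoint.
  - by move=> x [_ ?]; exact: halves_cover.
  - lra.
move=> c; rewrite !inE => /orP [] /eqP ->; split; try exact: cut_sub.
- split => //=; [split; first exact: clopenI|exact: trace_cutS].
  by apply: small_sub sO => x [].
- split => //=; [split; first exact: clopen_setD|exact: trace_cutS].
  by apply: small_sub sO => x [].
Qed.

Lemma fit_right n n' t : fitted n n' t ->
  exists L, refines L t /\ forall c, c \in L -> fitted n n'.+1 c /\ iV c `<=` iV t.
Proof.
move=> [[cF sF] [cO sO] ft tO e0]; set b := [set x | phi x n'].
have cb : clopen b by exact: cod_bit.
have [s0 s1] := halves sO; have [c0 c1] := clopen_halves n' cO.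
have cZF : closed (Z `&` iF t) by apply: closedI => //; exact: cF.2.
have [U [cU h0 h1]] := split_source cod cont cf cZF ft cb.
have e2 : 0 < ie t / 2 by rewrite divr_gt0.
pose a0 := Item (iF t `&` U) (iO t `&` b) (cut (iV t) b) (ie t / 2).
pose a1 := Item (iF t `\` U) (iO t `\` b) (cut (iV t) (~` b)) (ie t / 2).
have fit0 : fits (m (Z `&` (iF t `&` U))) (cut (iV t) b) -> fitted n n'.+1 a0 /\ iV a0 `<=` iV t.
  move=> ?; split; last exact: cut_sub.
  split => //=; [split; first exact: clopenI|exact: trace_cutS].
  by apply: small_sub sF => x [].
have fit1 : fits (m (Z `&` (iF t `\` U))) (cut (iV t) (~` b)) -> fitted n n'.+1 a1 /\ iV a1 `<=` iV t.
  move=> ?; split; last exact: cut_sub.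
  split => //=; [split; first exact: clopen_setD|exact: trace_cutS].
  by apply: small_sub sF => x [].
rewrite -setIA in h0; rewrite -setIDA in h1.
have ZF x : Z x -> iF t x -> (Z `&` (iF t `&` U)) x \/ (Z `&` (iF t `\` U)) x.
  by move=> Zx Fx; case: (pselect (U x)); [left|right].
case: h0 => h0; case: h1 => h1.
- exists [::]; split=> //; apply: refines0; [|by rewrite set0I|exact: ltW].
  by apply/seteqP; split=> x // [Zx /(ZF x Zx)]; rewrite h0 h1 => -[].
- exists [:: a1]; split; last by move=> c; rewrite inE => /eqP ->; exact: fit1.
  apply: refines1 => /=; try by move=> x [].
    by move=> x [Zx /(ZF x Zx)]; rewrite h0 => -[//|[_ []]].
  lra.
- exists [:: a0]; split; last by move=> c; rewrite inE => /eqP ->; exact: fit0.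
  apply: refines1 => /=; try by move=> x [].
    by move=> x [Zx /(ZF x Zx)]; rewrite h1 => -[[_ []]|//].
  lra.
exists [:: a0; a1]; split; last first.
  by move=> c; rewrite !inE => /orP [] /eqP ->; [exact: fit0|exact: fit1].
apply: refines2 => /=; try by move=> x [].
- exact: halves_disjoint.
- exact: halves_disjoint.
- by move=> x [_ ?]; exact: halves_cover.
- lra.
Qed.

(** The factor [r] lets the excess of the target over the source tend to [0] along the levels
while the budgets only have to be shared. *)
Lemma fit_tight n n' (r : R) t : 0 < r -> fitted n n' t ->
  exists L, refines L t /\ forall c, c \in L ->
    [/\ fitted n n' c, iV c `<=` iV t & m (iO c) < m (Z `&` iF c) + r * ie c].
Proof.
move=> r0 [[cF sF] [cO sO] ft tO e0].
have [P [cP lP fP]] := shrink_target cod cont cf (m_ge0 _ _) ft (mulr_gt0 r0 e0).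
exists [:: Item (iF t) (iO t `&` P) (cut (iV t) P) (ie t)]; split.
  by apply: refines1 => //= x [].
move=> c; rewrite inE => /eqP -> /=; split; [|exact: cut_sub|].
- split => //=; [split; first exact: clopenI|exact: trace_cutS].
  by apply: small_sub sO => x [].
- apply: le_lt_trans lP; apply: le_m; [|exact: Bor_clopen|by move=> x []].
  by apply: Bor_clopen; exact: clopenI.
Qed.

Lemma fit_split n (r : R) t : 0 < r -> fitted n n t ->
  exists L, refines L t /\ forall c, c \in L ->
    [/\ fitted n.+1 n.+1 c, iV c `<=` iV t & m (iO c) < m (Z `&` iF c) + r * ie c].
Proof.
move=> r0 ft; have [L1 [r1 h1]] := fit_left ft.
have [c cL|L2 [r2 h2]] := refines_all
    (P := fun c d => fitted n.+1 n.+1 d /\ iV d `<=` iV c) r1.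
  by have [fc _] := h1 c cL; exact: fit_right fc.
have [c cL|L3 [r3 h3]] := refines_all (P := fun c d => [/\ fitted n.+1 n.+1 d,
    iV d `<=` iV c & m (iO d) < m (Z `&` iF d) + r * ie d]) r2.
  by have [c1 _ [fc _]] := h2 c cL; exact: fit_tight.
exists L3; split=> // d dL; have [c cL [fd dc md]] := h3 d dL; split => //.
have [c1 c1L [_ cc]] := h2 c cL; have [_ ct] := h1 c1 c1L.
by apply: subset_trans ct; apply: subset_trans cc.
Qed.

End Splitting.

(** * Embedding a closed nowhere dense set into the closure of an analytic set *)

(** A node of the scheme. Its part inside the closed set [nS] is to be mapped along [nV];
the rest has been promised the smaller open set [nW], whose image lies in the clopen part
[nP] of [nO]. *)
Record node (R X M : Type) :=
  Node { nE : set X; nO : set X; nS : set X; nP : set X; nV : set M; nW : set M; ne : R }.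

HB.instance Definition _ (R X M : Type) := gen_eqMixin (node R X M).
HB.instance Definition _ (R X M : Type) := gen_choiceMixin (node R X M).

Section Nodes.
Variables (R : realType) (X : ptopologicalType).
Variable mu : {finite_measure set (borelType X) -> \bar R}.
Variable phi : X -> nat -> bool.
Hypothesis cod : coding phi.
Hypothesis cont : continuous_measure mu.
Hypothesis spos : strictly_positive mu.

Local Notation Bor A := (measurable (A : set (borelType X))).
Local Notation m := (m mu).

Variables (M : metricType R) (f : M -> X) (Q : set M).
Hypothesis cf : continuous f.

Local Notation fits := (fits mu f Q).
Local Notation trace := (trace f Q).
Local Notation cut := (cut f).

Hypothesis branching : forall V x, open V -> V `&` Q !=set0 -> exists2 y, trace V y & y <> x.

Variables (C : set X) (S : nat -> set X).
Hypothesis cC : closed C.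
Hypothesis cS : forall k, closed (S k).
Hypothesis room : m C = 0 \/
  (forall V, open V -> V `&` Q !=set0 -> 0 < m (closure (trace V))) /\
  (forall e : R, 0 < e -> exists k, m (C `\` S k) < e).

(** The excess bound halves at each level, so that the images of clopen sets have, in the
limit, no more measure than their sources. *)
Definition good_node n (t : node R X M) :=
  [/\ [/\ clopen (nE t), small phi n (nE t), clopen (nO t) & small phi n (nO t)],
      clopen (nP t) /\ (exists k, nS t = S k),
      [/\ fits (m (C `&` nS t `&` nE t)) (nV t), trace (nV t) `<=` nO t `\` nP t,
          fits (m ((C `&` nE t) `\` nS t)) (nW t) & trace (nW t) `<=` nO t `&` nP t],
      exists c, nW t `<=` ball c (n.+1%:R^-1 : R) &
      0 < ne t /\ m (nO t) < m (C `&` nE t) + 2^-1 ^+ n * ne t].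

(** Along an edge, either the left piece still touches the closed set of its parent, or the
reserve of the parent is used up. *)
Definition edge (t d : node R X M) :=
  [/\ nS d = nS t, nE d !=set0 -> C `&` nS t `&` nE d !=set0 & nV d `|` nW d `<=` nV t] \/
  nV d `|` nW d `<=` nW t.

Lemma BorC F : clopen F -> Bor (C `&` F).
Proof. by move=> cF; apply: measurableI; [exact: Bor_closed|exact: Bor_clopen]. Qed.

(** The reserve is chosen first; then [k] is taken so large that what [S k] misses fits into
the reserve. *)
Lemma node_of_item n F O V e : clopen F -> small phi n F -> clopen O -> small phi n O ->
  fits (m (C `&` F)) V -> trace V `<=` O -> 0 < e -> m O < m (C `&` F) + 2^-1 ^+ n * e ->
  exists d, [/\ good_node n d, nE d = F, nO d = O, ne d = e & nV d `|` nW d `<=` V].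
Proof.
move=> cF sF cO sO fV VO e0 hO.
have r0 : 0 < n.+1%:R^-1 :> R by rewrite invr_gt0.
have [[P W] /= [cP f1 fW WV [c Wc]]] := reserve cod cont cf branching (m_ge0 _ _) fV r0.
have BCF := BorC cF.
have WV' : W `<=` V by move=> x /WV [].
have [k hk] : exists k, fits (m ((C `&` F) `\` S k)) W.
  case: room => [h|[pos /(_ (m (closure (trace W)))) [|k hk]]].
  - exists 0%N; suff -> : m ((C `&` F) `\` S 0%N) = 0 by [].
    apply/eqP; rewrite eq_le m_ge0 andbT -[X in _ <= X]h; apply: le_m; [|exact: Bor_closed|].
      by apply: measurableD => //; exact: Bor_closed.
    by move=> x [[]].
  - by apply: pos; case: fW.
  - exists k; case: fW => oW nW _; split => //; right; apply: le_lt_trans hk.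
    apply: le_m; [|by apply: measurableD; exact: Bor_closed|].
      by apply: measurableD => //; exact: Bor_closed.
    by move=> x [[]].
exists (Node F O (S k) P (cut V (~` P)) W e); split => //=; last first.
  by move=> x [[]|/WV'].
split => //=; [by split=> //; exists k| |by exists c].
split => //.
- apply: fits_le f1; first exact: m_ge0.
  apply: le_m => //; first by rewrite setIAC; apply: measurableI => //; exact: Bor_closed.
  by move=> x [[]].
- exact: trace_cutS.
- apply: subset_trans (trace_subset WV) _; exact: trace_cutS.
Qed.

(** For a piece of [S k] the closed set is kept and the left side is shrunk to a
neighbourhood of the piece, so that what it contains outside [S k] fits into the new
reserve. *)
Lemma node_on_closed n F O V e k : clopen F -> small phi n F -> clopen O -> small phi n O ->
  fits (m (C `&` S k `&` F)) V -> trace V `<=` O -> 0 < e ->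
  m O < m (C `&` S k `&` F) + 2^-1 ^+ n * e ->
  exists d, [/\ good_node n d, nE d `<=` F /\ C `&` S k `&` F `<=` nE d,
    nO d = O /\ ne d = e, nS d = S k /\ (nE d !=set0 -> C `&` S k `&` nE d !=set0) &
    nV d `|` nW d `<=` V].
Proof.
move=> cF sF cO sO fV VO e0 hO.
have r0 : 0 < n.+1%:R^-1 :> R by rewrite invr_gt0.
have [[P W] /= [cP f1 fW WV [c Wc]]] := reserve cod cont cf branching (m_ge0 _ _) fV r0.
have WV' : W `<=` V by move=> x /WV [].
set Z := C `&` S k `&` F.
have cZ : closed Z by apply: closedI; [exact: closedI|exact: cF.2].
have BZ := Bor_closed cZ; have BC := Bor_closed cC; have BS := Bor_closed (@cS k).
have [p hp] : exists p, fits (m ((C `&` (F `&` thicken phi p Z)) `\` S k)) W.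
  case: room => [h|[pos _]].
  - exists 0%N; suff -> : m ((C `&` (F `&` thicken phi 0%N Z)) `\` S k) = 0 by [].
    apply/eqP; rewrite eq_le m_ge0 andbT -[X in _ <= X]h; apply: le_m => //.
      apply: measurableD => //; apply: BorC; apply: clopenI => //; exact: clopen_thicken.
    by move=> x [[]].
  - have [oW nW _] := fW; have [p hp] := m_thicken mu cod cZ (pos _ oW nW).
    exists p; split => //; right; have cN := clopen_thicken cod p Z.
    apply: (@le_lt_trans _ _ (m (thicken phi p Z `\` Z))).
      apply: le_m.
      + by apply: measurableD => //; apply: BorC; apply: clopenI.
      + by apply: measurableD => //; exact: Bor_clopen.
      + by move=> x [[Cx [Fx nx]] Sx]; split=> // -[[]].
    rewrite mD //; [lra|exact: Bor_clopen|exact: sub_thicken].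
have ZE : C `&` S k `&` (F `&` thicken phi p Z) = Z.
  by apply/seteqP; split=> [x [? []]//|x Zx]; split; [case: Zx|split; [case: Zx|exact: sub_thicken]].
have cE : clopen (F `&` thicken phi p Z) by apply: clopenI => //; exact: clopen_thicken.
exists (Node (F `&` thicken phi p Z) O (S k) P (cut V (~` P)) W e); split => //=.
- split => //=.
  + by split => //; apply: small_sub sF => x [].
  + by split => //; exists k.
  + split => //; [by rewrite ZE|exact: trace_cutS|].
    apply: subset_trans (trace_subset WV) _; exact: trace_cutS.
  + by exists c.
  + split => //; apply: lt_le_trans hO _; rewrite lerD2r -/Z; apply: le_m => //; first exact: BorC.
    by rewrite -{1}ZE => x [[]].
- by split=> x [] // Zx Fx; split => //; apply: sub_thicken.
- by split=> // -[x [Fx [z Zz _]]]; exists z; rewrite ZE.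
- by move=> x [[]|/WV'].
Qed.

Local Notation refinesN := (@refines R X _ (@nE R X M) (@nO R X M) (@ne R X M) C set0).

Lemma count_map_sub (T T' : choiceType) (A : T -> set X) (B : T' -> set X) (g : T' -> T) L x :
  (forall c, c \in L -> A (g c) `<=` B c) ->
  (count (fun d => x \in A d) (map g L) <= count (fun c => x \in B c) L)%N.
Proof.
elim: L => //= c L IH h; apply: leq_add; last by apply: IH => d dL; apply: h; rewrite inE dL orbT.
have [xA|//] := boolP (x \in A (g c)).
by rewrite mem_set //; apply: (h c (mem_head _ _)); exact: set_mem.
Qed.

(** The part of the node in its closed set goes along [nV] and defines neighbourhoods; only
then is the remainder [E2] known, and it goes along the reserve [nW]. *)
Lemma grow n t : good_node n t ->
  exists L, refinesN L t /\ forall d, d \in L -> good_node n.+1 d /\ edge t d.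
Proof.
move=> [[cE sE cO sO] [cP [k Sk]] [fV VO fW WO] [c0 Wc] [e0 hO]].
rewrite Sk in fV fW.
have e2 : 0 < ne t / 2 by rewrite divr_gt0.
have r0 : 0 < 2^-1 ^+ n.+1 :> R by rewrite exprn_gt0.
have cSk := @cS k; have cZ : closed (C `&` S k) by apply: closedI.
have [|L1 [[a1 a2 a3 _ a5] h1]] := @fit_split _ _ mu _ cod cont _ f Q cf branching _ cZ n _
    (Item (nE t) (nO t `\` nP t) (nV t) (ne t / 2)) r0.
  split => //=; split; first exact: clopen_setD.
  by apply: small_sub sO => x [].
have /choice [dn dnP] : forall c : item R X M, exists d, c \in L1 ->
    [/\ good_node n.+1 d, nE d `<=` iF c /\ C `&` S k `&` iF c `<=` nE d,
    nO d = iO c /\ ne d = ie c, nS d = S k /\ (nE d !=set0 -> C `&` S k `&` nE d !=set0) &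
    nV d `|` nW d `<=` iV c].
  move=> c; have [/h1 [[[? ?] [? ?] ? ? ?] _ ?]|] := boolP (c \in L1); last first.
    by exists (Node set0 set0 set0 set0 set0 set0 0).
  by have [] := @node_on_closed n.+1 (iF c) (iO c) (iV c) (ie c) k => // d ?; exists d.
pose E1 := \big[setU/set0]_(c <- L1) nE (dn c).
have cE1 : clopen E1.
  rewrite /E1 big_seq; elim/big_ind: _ => [|A B|c /dnP [[[]]]] //; first exact: clopen0.
  exact: clopenU.
have E1P x : E1 x -> exists2 c, c \in L1 & nE (dn c) x.
  by rewrite /E1 -bigcup_seq => -[c]; exists c.
pose E2 := nE t `\` E1.
have cE2 : clopen E2 by apply: clopen_setD.
have restS x : C x -> E2 x -> ~ S k x.
  move=> Cx [Ex nx] Sx; apply: nx; have [//|c cL cx] := a3 x _ Ex.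
  rewrite /E1 -bigcup_seq; exists c => //; have [_ [_ h] _ _ _] := dnP c cL.
  by apply: h.
have [|L2 [[b1 b2 b3 _ b5] h2]] := @fit_split _ _ mu _ cod cont _ f Q cf branching _ cC n _
    (Item E2 (nO t `&` nP t) (nW t) (ne t / 2)) r0.
  split => //=.
  - by split => //; apply: small_sub sE => x [].
  - by split; [exact: clopenI|apply: small_sub sO => x []].
  - apply: fits_le fW; [exact: m_ge0|apply: le_m].
    + exact: BorC.
    + by apply: measurableD; [exact: BorC|exact: Bor_closed].
    + by move=> x [Cx Ex]; split; [split => //; case: Ex|exact: restS].
have /choice [dr drP] : forall c : item R X M, exists d, c \in L2 ->
    [/\ good_node n.+1 d, nE d = iF c, nO d = iO c, ne d = ie c & nV d `|` nW d `<=` iV c].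
  move=> c; have [/h2 [[[? ?] [? ?] ? ? ?] _ ?]|] := boolP (c \in L2); last first.
    by exists (Node set0 set0 set0 set0 set0 set0 0).
  by have [] := @node_of_item n.+1 (iF c) (iO c) (iV c) (ie c) => // d ?; exists d.
exists (map dn L1 ++ map dr L2); split; last first.
  move=> d; rewrite mem_cat => /orP [] /mapP [c cL ->].
  - have [gd _ _ [nSd hd] VW] := dnP c cL; split => //; left; rewrite nSd Sk; split => //.
    by have [_ + _] := h1 c cL; exact: subset_trans.
  - have [gd _ _ _ VW] := drP c cL; split => //; right.
    by have [_ + _] := h2 c cL; exact: subset_trans.
have cntE1 x : (count (fun d => x \in nE d) (map dn L1) <= (x \in nE t))%N.
  by apply: leq_trans (a1 x); apply: count_map_sub => c /dnP [_ [h _] _ _ _].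
have cntE2 x : (count (fun d => x \in nE d) (map dr L2) <= (x \in E2))%N.
  by apply: leq_trans (b1 x); apply: count_map_sub => c /drP [_ -> _ _ _] y.
have cntO1 x : (count (fun d => x \in nO d) (map dn L1) <= (x \in nO t `\` nP t))%N.
  by apply: leq_trans (a2 x); apply: count_map_sub => c /dnP [_ _ [-> _] _ _] y.
have cntO2 x : (count (fun d => x \in nO d) (map dr L2) <= (x \in nO t `&` nP t))%N.
  by apply: leq_trans (b2 x); apply: count_map_sub => c /drP [_ _ -> _ _] y.
have memE (A : set X) x : A x -> (x \in A) = true by exact: mem_set.
have memN (A : set X) x : ~ A x -> (x \in A) = false by exact: memNset.
split.
- move=> x; rewrite count_cat; have := cntE2 x; have [xE2|nE2] := pselect (E2 x).
    have [Ex nx] := xE2; rewrite !memE // => c2.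
    rewrite (_ : count _ (map dn L1) = 0%N) //; apply/eqP.
    rewrite -leqn0 leqNgt -has_count; apply/hasPn => _ /mapP [c cL ->].
    rewrite memN // => dx; apply: nx.
    by rewrite /E1 -bigcup_seq; exists c.
  by rewrite memN // leqn0 => /eqP ->; rewrite addn0; exact: cntE1.
- move=> y; rewrite count_cat; have := cntO1 y; have := cntO2 y.
  have [yO|nyO] := pselect (nO t y); last first.
    rewrite (memN (nO t `&` nP t)); last by case.
    rewrite (memN (nO t `\` nP t)); last by case.
    by rewrite !leqn0 => /eqP -> /eqP ->.
  rewrite (memE (nO t)) //; have [yP|nyP] := pselect (nP t y).
    rewrite (memN (nO t `\` nP t)); last by case.
    move=> c2; rewrite leqn0 => /eqP ->; apply: leq_trans c2 _.
    by case: (_ \in _).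
  rewrite (memN (nO t `&` nP t)); last by case.
  rewrite leqn0 => /eqP -> c1; rewrite addn0; apply: leq_trans c1 _.
  by case: (_ \in _).
- move=> x Cx Ex; have [/E1P [c cL cx]|nx] := pselect (E1 x).
    by exists (dn c) => //; rewrite mem_cat; apply/orP; left; apply/mapP; exists c.
  have [//|c cL cx] := b3 x Cx.
  exists (dr c); first by rewrite mem_cat; apply/orP; right; apply/mapP; exists c.
  by have [_ -> _ _ _] := drP c cL.
- by [].
rewrite big_cat !big_map /=.
have -> : \sum_(c <- L1) ne (dn c) = \sum_(c <- L1) ie c.
  by rewrite big_seq [RHS]big_seq; apply: eq_bigr => c /dnP [_ _ []].
have -> : \sum_(c <- L2) ne (dr c) = \sum_(c <- L2) ie c.
  by rewrite big_seq [RHS]big_seq; apply: eq_bigr => c /drP [].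
move: a5 b5 => /=; lra.
Qed.

Hypothesis iC : C° = set0.
Hypothesis Mc : metric_complete M.
Hypothesis cQ : closed Q.
Hypothesis Q0 : Q !=set0.
Hypothesis large : m C = 0 \/ m C < m (closure (f @` Q)).

Lemma traceT : trace setT = f @` Q.
Proof. by rewrite /trace setTI. Qed.

Lemma root_node : exists t, good_node 0 t /\ nE t = setT /\ nO t = setT.
Proof.
(* The budget of the root exceeds the measure of the whole space. *)
have [||||||||t [gt tE tO _ _]] := @node_of_item 0 setT setT setT (m setT + 1).
- exact: clopenT.
- by [].
- exact: clopenT.
- by [].
- by split; [exact: openT|rewrite setTI|rewrite setIT traceT].
- by [].
- by have := m_ge0 mu setT; lra.
- by rewrite expr0 mul1r setIT; have := m_ge0 mu C; lra.
by exists t.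
Qed.

Lemma node_O_nonempty n t : good_node n t -> nO t !=set0.
Proof.
move=> [_ _ [[_ [p [Vp Qp]] _] VO _ _] _ _]; exists (f p).
by have [] := VO (f p) (ex_intro2 _ _ p (conj Vp Qp) erefl).
Qed.

Lemma node_lt n t : good_node n t -> m (C `&` nE t) < m (nO t).
Proof.
move=> [[cE _ cO _] [cP [k Sk]] [fV VO fW WO] _ _].
have BS := Bor_closed (@cS k).
have h1 := fits_lt spos (m_ge0 _ _) fV (clopen_setD cO cP) VO.
have h2 := fits_lt spos (m_ge0 _ _) fW (clopenI cO cP) WO.
rewrite Sk in h1 h2.
rewrite (mDI mu (BorC cE) BS) (mDI mu (Bor_clopen cO) (Bor_clopen cP)).
by rewrite setIAC in h1; lra.
Qed.

Lemma scheme_exists : exists (st : nat -> seq (node R X M)) (e0 : R),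
  [/\ scheme phi (@nE R X M) (@nO R X M) st,
      forall n t, t \in st n -> good_node n t,
      forall n d, d \in st n.+1 -> exists t, [/\ t \in st n, edge t d & nE d `<=` nE t],
      forall n x, C x -> exists2 t, t \in st n & nE t x &
      forall n, [/\ \sum_(t <- st n) ne t <= e0,
        forall x, (count (fun t => x \in nE t) (st n) <= 1)%N &
        forall x, (count (fun t => x \in nO t) (st n) <= 1)%N]].
Proof.
have [t [gt [tE tO]]] := root_node.
have [st [sr sP sQ]] := refinement_tree (Q := fun _ => edge) gt grow.
exists st, (ne t); split => //.
- split.
  + by move=> n c /sP [[[_ ?] ? [_ ?] ?] _ _ _ _].
  + by move=> n c d x cn dn; exact: (refines_uniqE (sr n) cn dn).
  + by move=> n c d x cn dn; exact: (refines_uniqO (sr n) cn dn).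
  + by move=> n d /sQ [c [? _ ? ?]]; exists c.
- by move=> n d /sQ [c [? ? ? ?]]; exists c.
- by move=> n x Cx; have [_ _ + _ _] := sr n; apply => //; rewrite tE.
move=> n; have [h1 h2 _ _ ?] := sr n; split => // x.
- by apply: leq_trans (h1 x) _; case: (_ \in _).
- by apply: leq_trans (h2 x) _; case: (_ \in _).
Qed.

(** Points of [C] outside every [S k] land in the image of [Q]: their branch uses up
reserves infinitely often, as otherwise the closed set attached to its nodes is eventually
constant and meets every neighbourhood of the point. *)
Lemma branch_range (st : nat -> seq (node R X M)) (c : nat -> node R X M) x y :
  (forall n t, t \in st n -> good_node n t) ->
  (forall n, c n \in st n) -> (forall n, nE (c n) x) -> (forall n, nO (c n) y) ->
  (forall n, edge (c n) (c n.+1)) -> (forall k, ~ S k x) -> (f @` Q) y.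
Proof.
move=> gst cst Ex Oy ed xS.
pose U n := nV (c n) `|` nW (c n).
have gc n : good_node n (c n) by exact: gst.
have UO n p : U n p -> Q p -> nO (c n) (f p).
  have [_ _ [_ VO _ WO] _ _] := gc n.
  move=> [Vp|Wp] Qp.
    by have [] := VO (f p) (ex_intro2 _ _ p (conj Vp Qp) erefl).
  by have [] := WO (f p) (ex_intro2 _ _ p (conj Wp Qp) erefl).
have UU n : U n.+1 `<=` U n.
  by case: (ed n) => [[_ _ h]|h]; apply: subset_trans h _ => z; [left|right].
have Umono n q : (n <= q)%N -> U q `<=` U n.
  elim: q => [|q IH]; first by rewrite leqn0 => /eqP ->.
  by rewrite leq_eqVlt => /orP [/eqP->//|]; rewrite ltnS => /IH nq; exact: subset_trans (UU q) nq.
have used n : exists2 q, (n <= q)%N & U q.+1 `<=` nW (c q).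
  apply: contrapT => no.
  have keep q : (n <= q)%N -> nS (c q.+1) = nS (c q) /\ (C `&` nS (c q) `&` nE (c q.+1) !=set0).
    move=> nq; case: (ed q) => [[h1 h2 _]|h]; last by case: no; exists q.
    by split => //; apply: h2; exists x.
  have same q : (n <= q)%N -> nS (c q) = nS (c n).
    elim: q => [|q IH]; first by rewrite leqn0 => /eqP ->.
    rewrite leq_eqVlt => /orP [/eqP->//|]; rewrite ltnS => nq.
    by rewrite (keep q nq).1; exact: IH.
  have [_ [_ [k Sk]] _ _ _] := gc n.
  have [p hp] := open_thicken1 cod (closed_openC (@cS k)) (xS k).
  have nq : (n <= maxn n p)%N by rewrite leq_maxl.
  have [_ [z [[_ Sz] Ez]]] := keep _ nq.
  rewrite (same _ nq) Sk in Sz; apply: (hp z) => //; rewrite thicken1.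
  have [[_ sE _ _] _ _ _ _] := gc (maxn n p).+1.
  apply: (@agree_le _ phi p (maxn n p).+1); last exact: sE.
  by rewrite leqW // leq_maxr.
have /choice [p pP] : forall n, exists p, nV (c n) p /\ Q p.
  by move=> n; have [_ _ [[_ [p ?] _] _ _ _] _ _] := gc n; exists p.
have pU n q : (n <= q)%N -> U n (p q) by move=> nq; apply: (Umono _ _ nq); left; have [] := pP q.
have [l pl] : exists l : M, p @ \oo --> l.
  have FF : ProperFilter (p @ \oo) by exact: fmap_proper_filter.
  apply: (Mc FF); apply: (@cauchy_exP R M (p @ \oo)) => e e0.
  have [N hN] : exists N, N.+1%:R^-1 < e :> R.
    by have [N hN] := ltr_add_invr e0; exists N; rewrite add0r in hN.
  have [q Nq hq] := used N; have [_ _ _ [a Wa] _] := gc q.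
  exists a; exists q.+1 => // r /= qr.
  apply: (@le_ball _ _ a (q.+1%:R^-1)); last by apply: Wa; apply: hq; exact: pU.
  by apply: le_trans (ltW hN); rewrite lef_pV2 ?posrE // ler_nat ltnS.
exists l; first by apply: (@closed_cvg nat M _ _ p Q cQ _ l pl); apply: nearW => n; case: (pP n).
apply: (agree_eq cod) => n.
have : (f \o p) @ \oo --> f l by apply: continuous_cvg => //; exact: cf.
move=> /(_ _ (open_nbhs_nbhs (conj (clopen_agree cod n (f l)).1 (@agreexx X phi n (f l))))).
move=> [N _ hN]; have /= a := hN (maxn N n) (leq_maxl _ _).
have [[_ _ _ sO] _ _ _ _] := gc (maxn N n).
apply: agree_trans (agree_sym a) _.
apply: (@agree_le _ phi n (maxn N n)); first exact: leq_maxr.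
by apply: sO => //; apply: UO; [exact: pU|case: (pP (maxn N n))].
Qed.

(** Measures are compared level by level: the pieces on the right exceed those on the left by
at most the total budget, and each piece on the left is strictly smaller than its partner.
So both the graph and its converse are thin, and [extension] applies to it. *)
Lemma embedding : exists G : X -> X -> Prop,
  [/\ thin mu G, thin mu (fun y x => G x y), forall x, C x -> exists y, G x y,
      forall x y, G x y -> closure (f @` Q) y &
      forall x y, G x y -> (forall k, ~ S k x) -> (f @` Q) y].
Proof.
have [st [e0 [sch gst ed cov bnd]]] := scheme_exists.
have sch' := scheme_sym sch.
pose H := limit (@nE R X M) (@nO R X M) st.
have H_fun x y z : H x y -> H x z -> y = z by exact: (limit_fun cod sch).
have H_inj x y z : H x z -> H y z -> x = y.
  by move=> /limit_sym h1 /limit_sym h2; exact: (limit_fun cod sch' h1 h2).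
have gE n t : t \in st n -> clopen (nE t) /\ clopen (nO t) by move=> /gst [[]].
exists (fun x y => C x /\ H x y); split.
- move=> A cA.
  have imE : img (fun x y => C x /\ H x y) A = [set y | exists2 x, (C `&` A) x & H x y].
    apply/seteqP; split=> y; first by move=> [x Ax [Cx h]]; exists x.
    by move=> [x [Cx Ax] h]; exists x.
  have clim : closed (img (fun x y => C x /\ H x y) A).
    by rewrite imE; apply: (limit_closed cod sch); apply: closedI => //; exact: cA.2.
  split=> //.
    apply/seteqP; split=> // y [[x Ax [_ h]] [x' Ax' [_ h']]].
    by apply: Ax'; rewrite -(H_inj _ _ _ h h').
  move=> A0; have lt := m_ndense spos cC iC cA A0.
  have [p pA] := clopen_level cod cA.
  have [n [pn hn]] : exists n, (p <= n)%N /\ 2^-1 ^+ n * e0 < m A - m (C `&` A).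
    have e1 : 0 < `|e0| + 1 by rewrite ltr_wpDl.
    have d0 : 0 < (m A - m (C `&` A)) / (`|e0| + 1) by apply: divr_gt0; [rewrite subr_gt0|].
    have half1 : `|2^-1 : R| < 1 by rewrite ger0_norm ?invr_ge0 // invf_lt1 // ltr1n.
    have /cvgrPdist_lt /(_ _ d0) [N _ hN] := cvg_expr half1.
    exists (maxn p N); split; first exact: leq_maxl.
    have /= := hN _ (leq_maxr p N).
    rewrite sub0r normrN ger0_norm ?exprn_ge0 ?invr_ge0 // => h.
    rewrite ltr_pdivlMr ?e1 // in h; apply: le_lt_trans h.
    by rewrite ler_wpM2l ?exprn_ge0 ?invr_ge0 // (le_trans (ler_norm _)) // lerDl.
  pose P := fun t : node R X M => `[< nE t `<=` A >].
  have [s1 c1 c2] := bnd n.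
  apply: (@le_lt_trans _ _ (\sum_(t <- st n | P t) m (nO t))).
    apply: m_le_sum; [by move=> t /gE [_ /Bor_clopen]|exact: Bor_closed|].
    move=> y [x Ax [Cx h]]; have [t tn [tx ty]] := h n.
    exists t; split => //; apply/asboolP => z tz; rewrite -pA; exists x => //.
    by have [[_ sE _ _] _ _ _ _] := gst _ _ tn; apply: agree_le pn _; exact: sE.
  apply: (@le_lt_trans _ _ (\sum_(t <- st n | P t) (m (C `&` nE t) + 2^-1 ^+ n * ne t))).
    rewrite big_seq_cond [leRHS]big_seq_cond; apply: ler_sum => t /andP [tn _].
    by have [_ _ _ _ [_ /ltW]] := gst _ _ tn.
  rewrite big_split /= -mulr_sumr.
  have l1 : \sum_(t <- st n | P t) m (C `&` nE t) <= m (C `&` A).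
    apply: sum_m_le c1 _ _; last exact: BorC.
    move=> t tn /asboolP tA; split; [by move=> x []|exact: setIS|apply: BorC].
    by have [] := gE _ _ tn.
  have l2 : \sum_(t <- st n | P t) ne t <= e0.
    apply: le_trans s1; rewrite big_mkcond /= !big_seq; apply: ler_sum => t tn.
    by case: ifP => // _; have [_ _ _ _ [/ltW]] := gst _ _ tn.
  have : 2^-1 ^+ n * \sum_(t <- st n | P t) ne t <= 2^-1 ^+ n * e0.
    by rewrite ler_wpM2l // exprn_ge0.
  lra.
- move=> B cB.
  have imE : img (fun y x => C x /\ H x y) B =
      C `&` [set x | exists2 y, B y & limit (@nO R X M) (@nE R X M) st y x].
    apply/seteqP; split=> x.
      by move=> [y By [Cx h]]; split => //; exists y => //; exact: limit_sym.
    by move=> [Cx [y By h]]; exists y => //; split => //; exact: limit_sym.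
  have clim : closed (img (fun y x => C x /\ H x y) B).
    by rewrite imE; apply: closedI => //; apply: (limit_closed cod sch'); exact: cB.2.
  split=> //.
    apply/seteqP; split=> // x [[y By [_ h]] [y' By' [_ h']]].
    by apply: By'; rewrite -(H_fun _ _ _ h h').
  move=> B0; have [n nB] := clopen_level cod cB.
  pose P := fun t : node R X M => `[< nO t `<=` B >].
  have [_ c1 c2] := bnd n.
  have le1 : m (img (fun y x => C x /\ H x y) B) <= \sum_(t <- st n | P t) m (C `&` nE t).
    apply: m_le_sum; [by move=> t /gE [+ _]; exact: BorC|exact: Bor_closed|].
    move=> x [y By [Cx h]]; have [t tn [tx ty]] := h n.
    exists t; split => //; apply/asboolP => z tz; rewrite -nB; exists y => //.
    by have [[_ _ _ sO] _ _ _ _] := gst _ _ tn; exact: sO.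
  have le2 : \sum_(t <- st n | P t) m (nO t) <= m B.
    apply: sum_m_le c2 _ _; last exact: Bor_clopen.
    move=> t tn /asboolP tA; split => //; apply: Bor_clopen.
    by have [] := gE _ _ tn.
  have [hP|nP] := boolP (has P (st n)).
    apply: le_lt_trans le1 _; apply: lt_le_trans le2.
    rewrite big_seq_cond [ltRHS]big_seq_cond; apply: ltr_sum.
      by move: hP => /hasP [t tn Pt]; apply/hasP; exists t => //; rewrite tn.
    by move=> t /andP [tn _]; exact: node_lt (gst _ _ tn).
  apply: le_lt_trans le1 _; rewrite big_hasC //; apply: m_gt0 => //; exact: cB.1.
- move=> x Cx; have [|y hy] := limit_total cod sch _ (fun n => cov n x Cx).
    by move=> n t /gst; exact: node_O_nonempty.
  by exists y.
- move=> x y [_ h] U /=; rewrite nbhsE => -[V [oV Vy] VU].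
  have [n hn] := open_thicken1 cod oV Vy.
  have [t tn [_ ty]] := h n.
  have [[_ _ _ sO] _ [[_ [p [Vp Qp]] _] VO _ _] _ _] := gst _ _ tn.
  exists (f p); split; first by exists p.
  apply: VU; apply: hn; rewrite thicken1; apply: sO => //.
  by have [] := VO (f p) (ex_intro2 _ _ p (conj Vp Qp) erefl).
- move=> x y [Cx h] xS.
  have [s1 s2 s3 s4] := sch.
  have [c [cst cx _ _]] := branch sch (fun n => cov n x Cx).
  apply: (branch_range (c := c) gst cst cx _ _ xS).
    by move=> n; exact: (limit_at sch h (cst n) (cx n)).
  move=> n; have [t [tn e tE]] := ed n _ (cst n.+1).
  by rewrite (s2 n (c n) t x (cst n) tn (cx n) (tE _ (cx n.+1))).
Qed.

End Nodes.

(** * Sigma-families and analytic sets *)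

(** Sigma-ideals, in the form that is checked for null, meager, countable and closed-null
sets. *)
Definition sigma_family (X : Type) (J : set (set X)) :=
  [/\ J set0, forall A B, A `<=` B -> J B -> J A &
      forall F : nat -> set X, (forall n, J (F n)) -> J (\bigcup_n F n)].

Section SigmaFamily.
Variables (X : Type) (J : set (set X)).
Hypothesis sJ : sigma_family J.

Lemma sigma_bigcup (T : countType) (F : T -> set X) :
  (forall t, J (F t)) -> J (\bigcup_t F t).
Proof.
move=> JF; have [J0 Js JU] := sJ.
apply: (Js _ (\bigcup_n if unpickle n is Some t then F t else set0)).
  by move=> x [t _ Fx]; exists (pickle t) => //; rewrite pickleK.
by apply: JU => n; case: (unpickle n).
Qed.

Lemma sigma_setU A B : J A -> J B -> J (A `|` B).
Proof.
move=> JA JB; have [J0 Js JU] := sJ.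
apply: (Js _ (\bigcup_n if n is 0%N then A else B)); last by apply: JU; case.
by move=> x [Ax|Bx]; [exists 0%N|exists 1%N].
Qed.

Lemma sigma_seq (T : choiceType) (s : seq T) (F : T -> set X) A :
  (forall x, A x -> exists2 t, t \in s & F t x) ->
  (forall t, t \in s -> J (A `&` F t)) -> J A.
Proof.
have [J0 Js JU] := sJ; elim: s A => [|t s IH] A cov h.
  by apply: Js J0 => x /cov [].
apply: (Js _ ((A `&` F t) `|` (A `\` F t))).
  by move=> x Ax; case: (pselect (F t x)); [left|right].
apply: sigma_setU; first exact: h (mem_head _ _).
apply: IH => [x [/cov [u + ux] nx]|u us].
  by rewrite inE => /orP [/eqP ut|us]; [rewrite ut in ux|exists u].
by apply: (Js _ (A `&` F u)); [move=> x [[]]|apply: h; rewrite inE us orbT].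
Qed.

End SigmaFamily.

Lemma sigma_ideal_family (X : Type) (I : set (set X)) : sigma_ideal I -> sigma_family I.
Proof.
move=> [idI sI].
have I0 : I set0.
  rewrite -(bigcup_set0 (fun A : set X => A)); apply: sI; first exact: countable0.
  by [].
split=> // [A B AB IB|F IF].
  by rewrite -(setIidr AB); have [] := idI B B A IB IB.
rewrite (_ : \bigcup_n F n = \bigcup_(A in range F) A).
  by apply: sI; [exact: card_image_le|move=> _ [n _ <-]].
by rewrite bigcup_image.
Qed.

Lemma sigma_countable (X : Type) : sigma_family [set A : set X | countable A].
Proof.
split=> [|A B AB|F cF] /=; first exact: countable0.
  exact: sub_countable (subset_card_le AB).
by apply: bigcup_countable => [|n _]; [exact: countableP|exact: cF].
Qed.

Section Meager.
Variable X : topologicalType.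

Lemma nowhere_dense_sub (A B : set X) : A `<=` B -> nowhere_dense B -> nowhere_dense A.
Proof.
move=> AB nB; apply/seteqP; split=> // x; rewrite -nB.
by apply: interiorS; exact: closure_subset.
Qed.

Lemma nowhere_dense0 : nowhere_dense (set0 : set X).
Proof. by rewrite /nowhere_dense closure0 interior0. Qed.

Lemma sigma_meager : sigma_family (meager_ideal X).
Proof.
split=> [|A B AB [F nF BE]|F mF].
- exists (fun=> set0); first by move=> _; exact: nowhere_dense0.
  by rewrite bigcup0.
- exists (fun n => F n `&` A); first by move=> n; apply: nowhere_dense_sub (nF n) => x [].
  by rewrite -setI_bigcupl -BE setIidr.
have [G GP] := choice (fun n => (let: ex_intro2 G a b := mF n in ex_intro _ G (conj a b)) :
  exists G : nat -> set X, (forall k, nowhere_dense (G k)) /\ F n = \bigcup_k G k).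
exists (fun i => if unpickle i is Some (n, k) then G n k else set0).
  move=> i; case: (unpickle i) => [[n k]|]; last exact: nowhere_dense0.
  by have [] := GP n.
apply/seteqP; split=> [x [n _]|x [i _]].
  by rewrite (GP n).2 => -[k _ Gx]; exists (pickle (n, k)) => //; rewrite pickleK.
case: (unpickle i) => [[n k]|] // Gx; exists n => //; rewrite (GP n).2.
by exists k.
Qed.

Lemma meager_closed (F : set X) : closed F -> F° = set0 -> meager_ideal X F.
Proof.
move=> cF iF; exists (fun=> F); last by apply/seteqP; split=> [x Fx|x [_ _]//]; exists 0%N.
by move=> _; rewrite /nowhere_dense -(closure_id F).1.
Qed.

End Meager.

Section Analytic.
Variables (R : realType) (X : topologicalType).

Definition dense_sequence (M : metricType R) (d : nat -> M) :=
  forall V : set M, open V -> V !=set0 -> exists n, V (d n).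

Lemma analytic_param (A : set X) : analytic R A -> A = set0 \/
  exists (M : metricType R) (f : M -> X) (d : nat -> M),
    [/\ metric_complete M, continuous f, dense_sequence d & A = range f].
Proof.
move=> [P [[D cD dD] [M Mc [h [g [hg gh ch cg]]]]] [f cf AE]].
have [A0|/set0P A0] := eqVneq A set0; [by left|right].
have [p0] : exists p : P, True by move: A0; rewrite AE => -[_ [p _ _]]; exists p.
move=> _; have /countable_injP [i iP] := cD.
have [d dP] : exists d : nat -> P, forall x, D x -> d (i x) = x.
  have /choice [d dP] : forall n, exists x, forall y, D y -> i y = n -> x = y.
    move=> n; have [[y [Dy yn]]|no] := pselect (exists y, D y /\ i y = n); last first.
      by exists p0 => y Dy yn; case: no; exists y.
    exists y => z Dz zn; apply: iP; rewrite ?inE //; last by rewrite yn zn.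
  by exists d => x Dx; exact: dP.
exists M, (f \o g), (h \o d); split => //.
- by move=> x; apply: continuous_comp; [exact: cg|exact: cf].
- move=> V oV [v Vv]; have [||p [Vp Dp]] := dD (h @^-1` V).
  + by exists (g v); rewrite /= gh.
  + by apply: open_comp => // x _; exact: ch.
  by exists (i p); rewrite /= dP.
- rewrite AE; apply/seteqP; split=> [_ [p _ <-]|_ [x _ <-]]; last by exists (g x).
  by exists (h p) => //=; rewrite hg.
Qed.

Variables (M : metricType R) (f : M -> X) (d : nat -> M).
Hypothesis cf : continuous f.
Hypothesis dd : dense_sequence d.

Definition dball (nk : nat * nat) : set M := (ball (d nk.1) (nk.2.+1%:R^-1 : R))°.

Lemma dball_basis (V : set M) p : open V -> V p -> exists nk, dball nk p /\ dball nk `<=` V.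
Proof.
move=> oV Vp; have /nbhs_ballP [e /= e0 eV] : nbhs p V by exact: open_nbhs_nbhs.
have [k] := ltr_add_invr (divr_gt0 e0 (ltr0Sn R 1)) => /=.
rewrite add0r; set r := k.+1%:R^-1 => hr.
have r0 : 0 < r by rewrite invr_gt0.
have r2 : 0 < r / 2 by rewrite divr_gt0.
have [||n hn] := dd (V := (ball p (r / 2))°); first exact: open_interior.
  by exists p; apply: nbhsx_ballx.
have pn : ball (d n) (r / 2) p by apply: ball_sym; exact: interior_subset hn.
exists (n, k); split; rewrite /dball /= -/r.
  have := nbhsx_ballx p _ r2; apply: filterS => q pq.
  by rewrite (splitr r); exact: ball_triangle pn pq.
move=> q /interior_subset nq; apply: eV.
apply: (@le_ball _ _ p (r / 2 + r)); first by lra.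
apply: ball_triangle nq; exact: ball_sym.
Qed.

(** Removing from [Q1] the balls with image in [J] loses only a set with image in [J], as
countably many balls suffice; what remains is nowhere [J]-small. *)
Lemma nowhere_small_part (J : set (set X)) (Q1 : set M) : sigma_family J -> closed Q1 ->
  exists Q, [/\ closed Q, Q `<=` Q1, J (f @` (Q1 `\` Q)) &
    forall V, open V -> V `&` Q !=set0 -> ~ J (f @` (V `&` Q))].
Proof.
move=> sJ cQ1; have [J0 Js JU] := sJ.
pose small nk := J (f @` (dball nk `&` Q1)).
pose W := \bigcup_nk (if `[< small nk >] then dball nk else set0).
have oW : open W.
  by apply: bigcup_open => nk _; case: ifP => _; [exact: open_interior|exact: open0].
exists (Q1 `\` W).
have lost : J (f @` (Q1 `\` (Q1 `\` W))).
  apply: (Js _ (\bigcup_nk (if `[< small nk >] then f @` (dball nk `&` Q1) else set0))).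
    move=> _ [x [Qx nx] <-].
    have [nk _ hx] : W x by apply: contrapT => Wx; apply: nx.
    exists nk => //; move: hx; case: ifP => // _ Bx; exists x => //.
  by apply: (sigma_bigcup sJ) => nk; case: ifP => // /asboolP.
split => //.
  by apply: closedI => //; exact: open_closedC.
move=> V oV [q [Vq [Qq nWq]]] JV; apply: nWq.
have [nk [Bq BV]] := dball_basis oV Vq.
exists nk => //; rewrite asboolT //; apply: Js (sigma_setU sJ JV lost).
move=> _ [x [Bx Qx] <-]; case: (pselect (W x)) => Wx.
  by right; exists x => //; split => // -[].
by left; exists x => //; split; [exact: BV|].
Qed.

Hypothesis Mc : metric_complete M.

Lemma dball_cover k p : exists n, dball (n, k) p.
Proof.
set r : R := k.+1%:R^-1.
have r0 : 0 < r by rewrite invr_gt0.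
have r2 : 0 < r / 2 by rewrite divr_gt0.
have [||n hn] := dd (V := (ball p (r / 2))°); first exact: open_interior.
  by exists p; apply: nbhsx_ballx.
have pn : ball (d n) (r / 2) p by apply: ball_sym; exact: interior_subset hn.
exists n; rewrite /dball /= -/r.
have := nbhsx_ballx p _ r2; apply: filterS => q pq.
by rewrite (splitr r); exact: ball_triangle pn pq.
Qed.

(** Marczewski's argument: with a hull for every set, the image of [M] contains its hull up
to a [J]-small set, namely the union of the errors made when the pieces of the Souslin
scheme of [f] are replaced by their hulls. *)
Lemma range_contains_hull (phi : X -> nat -> bool) (J : set (set X)) (H : set X -> set X) :
  coding phi -> sigma_family J -> (forall Y, H Y `<=` closure Y) ->
  (forall Y : nat -> set X, J (H (\bigcup_n Y n) `\` \bigcup_n H (Y n))) ->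
  exists2 Z, J Z & H (range f) `\` Z `<=` range f.
Proof.
move=> cod sJ Hcl HU.
pose V := fix V s := if s is n :: s' then V s' `&` dball (n, size s') else [set: M].
have VE s : V s = \bigcup_n V (n :: s).
  apply/seteqP; split=> [x Vx|x [n _ []//]].
  by have [n hn] := dball_cover (size s) x; exists n.
pose err s := H (f @` V s) `\` \bigcup_n H (f @` V (n :: s)).
exists (\bigcup_s err s).
  apply: (sigma_bigcup sJ) => s; rewrite /err {1}VE image_bigcup; exact: HU.
move=> x [Hx nx].
have /choice [nxt nxtP] : forall s, exists n, H (f @` V s) x -> H (f @` V (n :: s)) x.
  move=> s; have [hx|] := pselect (H (f @` V s) x); last by exists 0%N.
  have [n _ hn] : (\bigcup_n H (f @` V (n :: s))) x.
    by apply: contrapT => h; apply: nx; exists s.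
  by exists n.
pose path k := iter k (fun s => nxt s :: s) [::].
have pathH k : H (f @` V (path k)) x by elim: k => [|k IH] //=; exact: nxtP.
have size_path k : size (path k) = k by elim: k => //= k ->.
have Vsub k : V (path k.+1) `<=` ball (d (nxt (path k))) (k.+1%:R^-1 : R).
  by move=> y [_]; rewrite size_path => /interior_subset.
have Vmono k q : (k <= q)%N -> V (path q) `<=` V (path k).
  elim: q => [|q IH]; first by rewrite leqn0 => /eqP ->.
  rewrite leq_eqVlt => /orP [/eqP->//|]; rewrite ltnS => /IH kq.
  by apply: subset_trans kq => y [].
have /choice [p pV] : forall k, exists y, V (path k) y.
  move=> k; have [_ [[y Vy _] _]] := Hcl _ _ (pathH k) setT filterT.
  by exists y.
have [l pl] : exists l : M, p @ \oo --> l.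
  have FF : ProperFilter (p @ \oo) by exact: fmap_proper_filter.
  apply: (Mc FF); apply: (@cauchy_exP R M (p @ \oo)) => e e0.
  have [k] := ltr_add_invr e0; rewrite add0r => /ltW ke.
  exists (d (nxt (path k))); exists k.+1 => // q /= kq.
  by apply: le_ball ke _ _; apply: Vsub; apply: Vmono kq _ (pV q).
exists l => //; apply: (agree_eq cod) => n; apply: agree_sym.
have cN := clopen_thicken cod n [set f l].
suff : thicken phi n [set f l] x by rewrite thicken1.
apply: cN.2.
have /nbhs_ballP [e /= e0 he] : nbhs l (f @^-1` thicken phi n [set f l]).
  by apply: cf; apply: open_nbhs_nbhs; split; [exact: cN.1|exact: sub_thicken].
have [k] := ltr_add_invr (divr_gt0 e0 (ltr0Sn R 2)).
rewrite add0r; set r := k.+1%:R^-1 => hr.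
have r0 : 0 < r by rewrite invr_gt0.
have [N _ hN] := pl _ (nbhsx_ballx l r r0).
apply: closure_subset (Hcl _ _ (pathH k.+1)) => _ [y Vy <-]; apply: he.
pose q := maxn N k.+1.
have lq : ball l r (p q) by apply: hN; rewrite /= leq_maxl.
have dq : ball (d (nxt (path k))) r (p q).
  by apply: Vsub; apply: Vmono (pV q); rewrite leq_maxr.
apply: (@le_ball _ _ l (r + r + r)); first by lra.
by apply: ball_triangle (Vsub _ _ Vy); apply: ball_triangle lq (ball_sym dq).
Qed.

End Analytic.

(** * Measurable and meager hulls *)

Section Hulls.
Variables (R : realType) (X : ptopologicalType).
Variable mu : {finite_measure set (borelType X) -> \bar R}.
Variable phi : X -> nat -> bool.
Hypothesis cod : coding phi.

Local Notation Bor A := (measurable (A : set (borelType X))).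
Local Notation m := (m mu).

Lemma nullP A : null_ideal mu A <-> exists B, [/\ Bor B, m B = 0 & A `<=` B].
Proof.
split=> [[B [BB mB AB]]|[B [BB mB AB]]]; exists B; split => //.
  by rewrite /m mB.
by rewrite (mE mu) // mB.
Qed.

Lemma sigma_null : sigma_family (null_ideal mu).
Proof.
split; first exact: negligible_set0.
- by move=> A B AB; exact: negligibleS.
- by move=> F nF; exact: negligible_bigcup.
Qed.

Lemma sigma_closed_null : sigma_family (closed_null_ideal mu).
Proof.
split=> [|A B AB [F hF BF]|F hF].
- by exists (fun=> set0) => // n; split; [exact: closed0|exact: measure0].
- by exists F => //; exact: subset_trans BF.
have [G GP] := choice (fun n => (let: ex_intro2 G a b := hF n in ex_intro _ G (conj a b)) :
  exists G : nat -> set X, (forall k, closed (G k) /\ mu (G k) = 0%E) /\ F n `<=` \bigcup_k G k).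
exists (fun i => if unpickle i is Some (n, k) then G n k else set0).
  move=> i; case: (unpickle i) => [[n k]|]; first exact: (GP n).1.
  by split; [exact: closed0|exact: measure0].
move=> x [n _ /(GP n).2 [k _ Gx]].
by exists (pickle (n, k)) => //; rewrite pickleK.
Qed.

Lemma closed_null_mem C A : closed C -> m C = 0 -> A `<=` C -> closed_null_ideal mu A.
Proof.
move=> cC mC AC; exists (fun=> C).
  move=> _; split => //; by rewrite (mE mu) ?mC //; exact: Bor_closed.
by move=> x /AC Cx; exists 0%N.
Qed.

Lemma null_of_le A B : Bor B -> m B <= 0 -> A `<=` B -> null_ideal mu A.
Proof.
move=> BB mB AB; apply/nullP; exists B; split => //.
by apply/eqP; rewrite eq_le mB m_ge0.
Qed.

(** A Borel superset of minimal measure, obtained as an intersection along a minimizing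
sequence. *)
Lemma measurable_hull Y : exists W, [/\ Bor W, Y `<=` W &
  forall B, Bor B -> Y `<=` B -> m (W `\` B) = 0].
Proof.
pose V := [set r | exists B, [/\ Bor B, Y `<=` B & r = m B]].
have hV : has_inf V.
  split; first by exists (m setT), setT; split => //; exact: measurableT.
  by exists 0 => _ [B [_ _ ->]]; exact: m_ge0.
have /choice [B BP] : forall n : nat, exists B, [/\ Bor B, Y `<=` B & m B < inf V + n.+1%:R^-1].
  move=> n; have n0 : 0 < n.+1%:R^-1 :> R by rewrite invr_gt0.
  by have [_ [B [BB YB ->]] h] := inf_adherent n0 hV; exists B.
pose W := \bigcap_n B n.
have BW : Bor W by apply: bigcapT_measurable => n; case: (BP n).
have mW : m W <= inf V.
  apply/ler_addgt0Pr => e e0; have [n] := ltr_add_invr e0; rewrite add0r => ne.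
  have [Bn _ h] := BP n.
  have : m W <= m (B n) by apply: le_m => //; exact: bigcap_inf.
  by move=> /le_trans; apply; apply/ltW/(lt_trans h); rewrite ltrD2l.
exists W; split => // [y Yy n _|D BD YD]; first by have [_ + _] := BP n; apply.
have h : inf V <= m (W `&` D).
  apply: ge_inf; first by case: hV.
  exists (W `&` D); split => //; first exact: measurableI.
  by move=> y Yy; split; [move=> n _; have [_ + _] := BP n; apply|exact: YD].
by apply/eqP; rewrite eq_le m_ge0 andbT; have := mDI mu BW BD; lra.
Qed.

(** The Banach category theorem; here countably many cells suffice. *)
Lemma meager_hull_part Y : let W := \bigcup_(U in [set U | open U /\ meager_ideal X (U `&` Y)]) U in
  meager_ideal X (W `&` Y).
Proof.
move=> W; have sM := @sigma_meager X; have [M0 Ms MU] := sM.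
pose c (ni : nat * nat) := nth set0 (cells phi ni.1) ni.2.
apply: (Ms _ (\bigcup_ni (if `[< meager_ideal X (c ni `&` Y) >] then c ni `&` Y else set0))).
  move=> y [[U [oU mU'] Uy] Yy].
  have [n nU] := open_thicken1 cod oU Uy.
  have [A An Ay] := cells_cover phi n y.
  exists (n, index A (cells phi n)) => //.
  rewrite /c /= nth_index // asboolT //; apply: Ms mU' => z [Az Yz]; split => //.
  apply: nU; rewrite thicken1 /=; have [_ sA] := cellsP cod An; exact: sA.
by apply: (sigma_bigcup sM) => ni; case: ifP => // /asboolP.
Qed.

Definition meager_hull Y : set X :=
  ~` \bigcup_(U in [set U | open U /\ meager_ideal X (U `&` Y)]) U.

Lemma meager_hull_closed Y : closed (meager_hull Y).
Proof. by apply: open_closedC; apply: bigcup_open => U []. Qed.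

Lemma meager_hullD Y : meager_ideal X (Y `\` meager_hull Y).
Proof. by rewrite setDE setCK setIC; exact: meager_hull_part. Qed.

(** In the interior of the hull of the union, the interiors of the hulls of the parts are
dense: on an open set missing them every part would be meager, and so would be the union. *)
Lemma meager_hull_error (Y : nat -> set X) :
  meager_ideal X (meager_hull (\bigcup_n Y n) `\` \bigcup_n meager_hull (Y n)).
Proof.
have sM := @sigma_meager X; have [M0 Ms MU] := sM.
set F := meager_hull _; pose Fn n := meager_hull (Y n).
pose G := \bigcup_n (Fn n)°.
have oG : open G by apply: bigcup_open => n _; exact: open_interior.
have rim (D : set X) : closed D -> meager_ideal X (D `\` D°).
  move=> cD; apply: meager_closed.
    by apply: closedI => //; apply: open_closedC; exact: open_interior.
  apply/seteqP; split=> // x h; have [_ nx] := interior_subset h; apply: nx.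
  by apply: interiorS h => y [].
have edge : meager_ideal X (closure G `\` G).
  apply: meager_closed.
    by apply: closedI; [exact: closed_closure|exact: open_closedC].
  apply/seteqP; split=> // x h; have [cx _] := interior_subset h.
  by have [y [Gy /= [_ nGy]]] := cx _ h.
have FG : F° `<=` closure G.
  move=> x Fx; apply: contrapT => nx.
  pose W := F° `&` ~` closure G.
  have oW : open W by apply: openI; [exact: open_interior|exact: closed_openC (@closed_closure _ _)].
  have : F x by exact: interior_subset Fx.
  apply; exists W; last by split.
  split => //; apply: (Ms _ ((\bigcup_n (Fn n `\` (Fn n)°)) `|` \bigcup_n (Y n `\` Fn n))).
    move=> y [[_ ny] [n _ Yy]]; case: (pselect (Fn n y)) => h; [left|right]; exists n => //.
    by split => // h'; apply: ny; apply: subset_closure; exists n.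
  apply: (sigma_setU sM); apply: MU => n; last exact: meager_hullD.
  by apply: rim; exact: meager_hull_closed.
apply: (Ms _ ((F `\` F°) `|` (closure G `\` G))).
  move=> x [Fx nx]; case: (pselect (F° x)) => h; [right|by left].
  split; first exact: FG.
  by move=> [n _ /interior_subset hn]; apply: nx; exists n.
by apply: (sigma_setU sM) => //; apply: rim; exact: meager_hull_closed.
Qed.

Variables (M : metricType R) (f : M -> X) (d : nat -> M).
Hypothesis cf : continuous f.
Hypothesis dd : dense_sequence d.
Hypothesis Mc : metric_complete M.

(** With measurable hulls the errors in [range_contains_hull] are null, so the range is a Borel
set up to a null set, and regularity applies. *)
Lemma range_closed_part : ~ null_ideal mu (range f) ->
  exists K, [/\ closed K, K `<=` range f & 0 < m K].
Proof.
move=> nn; have /choice [W WP] := measurable_hull.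
have BW Y : Bor (W Y `&` closure Y).
  by apply: measurableI; [case: (WP Y)|apply: Bor_closed; exact: closed_closure].
have [|Y|Z /nullP [N [BN mN ZN]] hZ] :=
  range_contains_hull cf dd Mc (H := fun Y => W Y `&` closure Y) cod sigma_null.
- by move=> Y x [].
- apply/nullP; exists (W (\bigcup_n Y n) `\` \bigcup_n (W (Y n) `&` closure (Y n))).
  have BU : Bor (\bigcup_n (W (Y n) `&` closure (Y n))) by apply: bigcupT_measurable.
  have [B1 _ h1] := WP (\bigcup_n Y n).
  split; [exact: measurableD| |by move=> x [[]]].
  apply: h1 => // x [n _ Yx]; exists n => //; split; last exact: subset_closure.
  by have [_ + _] := WP (Y n); apply.
set T := W (range f) `&` closure (range f).
have BTN : Bor (T `\` N) by apply: measurableD => //; exact: BW.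
have mT : 0 < m (T `\` N).
  rewrite ltNge; apply/negP => h; apply: nn.
  apply: (null_of_le (B := (T `\` N) `|` N)).
  - exact: measurableU.
  - by apply: le_trans (mU_le mu BTN BN) _; rewrite mN addr0.
  - move=> x fx; case: (pselect (N x)) => Nx; [by right|left; split => //].
    by split; [have [_ + _] := WP (range f); apply|exact: subset_closure].
have [[F U] /= [cF oU FT TU h]] := regular mu cod BTN mT.
exists F; split => //.
  by move=> x /FT [Tx Nx]; apply: hZ; split => // /ZN.
have := le_m mu BTN (Bor_open oU) TU.
have := mD mu (Bor_open oU) (Bor_closed cF) (subset_trans FT TU).
lra.
Qed.

(** The meager hull is closed and contains the range up to a meager set, so it has interior
points when the range is not meager; by [range_contains_hull] the range is comeager there. *)
Lemma range_comeager_part : ~ meager_ideal X (range f) ->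
  exists U, [/\ open U, U !=set0 & meager_ideal X (U `\` range f)].
Proof.
move=> nm; have sM := @sigma_meager X; have [M0 Ms MU] := sM.
have [|Z mZ hZ] := range_contains_hull cf dd Mc (H := meager_hull) cod sM _ meager_hull_error.
  move=> Y x hx U Ux; apply: contrapT => no; apply: hx.
  move: Ux; rewrite nbhsE => -[V [oV Vx] VU]; exists V => //; split => //.
  suff -> : V `&` Y = set0 by [].
  by apply/seteqP; split=> // y [Vy Yy]; apply: no; exists y; split => //; exact: VU.
exists (meager_hull (range f))°; split; first exact: open_interior.
  apply/set0P/eqP => h; apply: nm.
  apply: (Ms _ (meager_hull (range f) `|` (range f `\` meager_hull (range f)))).
    by move=> x fx; case: (pselect (meager_hull (range f) x)); [left|right].
  apply: (sigma_setU sM); last exact: meager_hullD.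
  by apply: meager_closed => //; exact: meager_hull_closed.
apply: Ms mZ => x [/interior_subset hx nx]; apply: contrapT => Zx; apply: nx.
by apply: hZ.
Qed.

End Hulls.

(** * Classification *)

(** A 0-1 sequence is sent to the number with these digits in base 3 (up to scaling), where
the first difference outweighs all later digits. *)
Lemma sequence_injection (R : realType) : exists g : (nat -> bool) -> R, injective g.
Proof.
pose S (x : nat -> bool) n : R := \sum_(k < n) (x k)%:R * 3^-1 ^+ k.
(* [T n] is the sum of the geometric series of the powers of 1/3 from the [n]th on. *)
pose T n : R := 3^-1 ^+ n * (3 / 2).
have T0 n : 0 <= T n by rewrite mulr_ge0 ?exprn_ge0 ?invr_ge0 // divr_ge0.
have SS x n : S x n.+1 = S x n + (x n)%:R * 3^-1 ^+ n by rewrite /S big_ord_recr.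
have Sle x n p : (n <= p)%N -> S x p + T p <= S x n + T n.
  elim: p => [|p IH]; first by rewrite leqn0 => /eqP ->.
  rewrite leq_eqVlt => /orP [/eqP->//|]; rewrite ltnS => /IH; apply: le_trans.
  rewrite SS /T exprS; have : 0 <= 3^-1 ^+ p :> R by rewrite exprn_ge0 ?invr_ge0.
  by case: (x p) => /=; lra.
have Sge x n p : (n <= p)%N -> S x n <= S x p.
  elim: p => [|p IH]; first by rewrite leqn0 => /eqP ->.
  rewrite leq_eqVlt => /orP [/eqP->//|]; rewrite ltnS => /IH /le_trans; apply.
  by rewrite SS lerDl mulr_ge0 // exprn_ge0 // invr_ge0.
have Sub x n p : S x p <= S x n + T n.
  have [np|pn] := leqP n p; first by apply: le_trans (Sle x n p np); rewrite lerDl.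
  by apply: le_trans (Sge x p n (ltnW pn)) _; rewrite lerDl.
pose g x := sup (range (S x)).
have hs x : has_sup (range (S x)).
  split; first by exists (S x 0%N), 0%N.
  by exists (S x 0%N + T 0%N) => _ [p _ <-]; exact: Sub.
have lt (x y : nat -> bool) n : (forall k, (k < n)%N -> x k = y k) -> x n -> ~~ y n -> g y < g x.
  move=> xy xn yn.
  have e : S x n = S y n by apply: eq_bigr => k _; rewrite xy.
  have h1 : S x n.+1 <= g x by apply: sup_upper_bound; [exact: hs|exists n.+1].
  have h2 : g y <= S y n.+1 + T n.+1.
    by apply: ge_sup; [case: (hs y)|move=> _ [p _ <-]; exact: Sub].
  move: h1 h2; rewrite !SS xn (negbTE yn) e /T exprS /=.
  have : 0 < 3^-1 ^+ n :> R by rewrite exprn_gt0 // invr_gt0.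
  lra.
exists g => x y gxy; apply: contrapT => nxy.
have [n nn] : exists n, x n != y n.
  by apply: contrapT => no; apply: nxy; apply: funext => n;
    apply/eqP/negPn/negP => h; apply: no; exists n.
have ex : exists n, x n != y n by exists n.
have xy k : (k < ex_minn ex)%N -> x k = y k.
  case: ex_minnP => p _ hp kp; apply/eqP/negPn/negP => /hp; by rewrite leqNgt kp.
have := xy; case: ex_minnP => p np _ xyp.
case xp : (x p); case yp : (y p); rewrite ?xp ?yp // in np.
- by have := lt x y p xyp; rewrite xp yp gxy ltxx => /(_ isT isT).
- by have := lt y x p (fun k kp => esym (xyp k kp)); rewrite xp yp gxy ltxx => /(_ isT isT).
Qed.

Section Classification.
Variables (R : realType) (X : ptopologicalType).
Variable mu : {finite_measure set (borelType X) -> \bar R}.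
Variable phi : X -> nat -> bool.
Hypothesis cod : coding phi.
Hypothesis cont : continuous_measure mu.
Hypothesis spos : strictly_positive mu.
Hypothesis scond : subset_condition mu.

Local Notation Bor A := (measurable (A : set (borelType X))).
Local Notation m := (m mu).

(** Points are null, so the graph consisting of one pair of points is thin. *)
Lemma transitive_action x y : exists h, measure_preserving_homeomorphism mu h /\ h x = y.
Proof.
have pt (a b : X) : thin mu (fun u v => u = a /\ v = b).
  move=> A cA; have imgE (B : set X) z : img (fun u v => u = a /\ v = b) B z <-> B a /\ z = b.
    by split=> [[u Bu [<- ->]]|[Ba ->]]; [|exists a].
  have sub : img (fun u v => u = a /\ v = b) A `<=` [set b] by move=> z /imgE [].
  split.
  - have [Aa|nAa] := pselect (A a).
      by rewrite (_ : img _ _ = [set b]);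
        [exact: (closed1 cod)|apply/seteqP; split => // z ->; apply/imgE].
    by rewrite (_ : img _ _ = set0); [exact: closed0|apply/seteqP; split=> // z /imgE []].
  - by apply/seteqP; split=> // z [/imgE [Aa _] /imgE []].
  - move=> A0; apply: (@le_lt_trans _ _ 0); last by apply: m_gt0 => //; exact: cA.1.
    rewrite -(m1 cont b); have Bb : Bor [set b] by apply: Bor_closed; exact: (closed1 cod).
    have [->|b'] : 
      img (fun u v => u = a /\ v = b) A = set0 \/ img (fun u v => u = a /\ v = b) A = [set b].
    + exact: subset_set1.
    + by rewrite m0 m_ge0.
    + by rewrite b'.
have pt' : thin mu (fun v u => u = x /\ v = y).
  rewrite (_ : (fun _ _ => _) = fun u v : X => u = y /\ v = x); first exact: pt.
  by apply: funext => u; apply: funext => v; apply/propext; split=> -[].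
have [h [hm hG]] := extension cod spos scond (pt x y) pt'.
by exists h; split => //; apply: hG.
Qed.

Variable I : set (set X).
Hypothesis sI : sigma_family I.
Hypothesis ab : analytic_base R I.
Hypothesis inv : invariant_family mu I.

Lemma I_sub A B : A `<=` B -> I B -> I A.
Proof. by case: sI => _ + _; apply. Qed.

Lemma I_preimage h A B : measure_preserving_homeomorphism mu h -> I A ->
  (forall x, B x -> A (h x)) -> I B.
Proof.
move=> hm; have [[g [hg gh _ _]] _] := hm.
rewrite -{1}(inv hm) => -[A' IA' <-] BA; apply: I_sub IA' => x /BA [y A'y].
by move=> /(can_inj hg) <-.
Qed.

Lemma I_image h A : measure_preserving_homeomorphism mu h -> I A -> I (h @` A).
Proof. by move=> hm IA; rewrite -(inv hm); exists A. Qed.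

Lemma countable_in A0 : I A0 -> A0 !=set0 -> forall A, countable A -> I A.
Proof.
move=> IA0 [x0 A0x] A cA; have [I0 Is IU] := sI.
have I1 x : I [set x].
  have [h [hm hx]] := transitive_action x x0.
  by apply: (I_preimage hm IA0) => _ ->; rewrite hx.
have /countable_injP [i iP] := cA.
apply: (Is _ (\bigcup_n [set x | A x /\ i x = n])).
  by move=> x Ax; exists (i x).
apply: IU => n; have [[x [Ax xn]]|no] := pselect (exists x, A x /\ i x = n); last first.
  by apply: Is I0 => y hy; apply: no; exists y.
apply: (Is _ [set x]) => // y [Ay yn]; apply: iP; rewrite ?inE //.
by rewrite xn yn.
Qed.

Lemma interior_null C : Bor C -> m C = 0 -> C° = set0.
Proof.
move=> BC mC; apply/seteqP; split=> // x Cx.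
have : 0 < m C°; first by apply: m_gt0 => //; [exact: open_interior|exists x].
rewrite ltNge -mC => /negP; apply; apply: le_m => //; last exact: interior_subset.
by apply: Bor_open; exact: open_interior.
Qed.

Lemma I_param A : I A -> A !=set0 ->
  exists (M : metricType R) (f : M -> X) (d : nat -> M),
    [/\ metric_complete M, continuous f, dense_sequence d, I (range f) & A `<=` range f].
Proof.
move=> IA [x Ax]; have [B [IB anB AB]] := ab IA.
have [B0|[M [f [d [? ? ? BE]]]]] := analytic_param anB.
  by have := AB _ Ax; rewrite B0.
by exists M, f, d; rewrite -BE.
Qed.

Section Absorb.
Variables (M : metricType R) (f : M -> X) (Q : set M).
Hypothesis Mc : metric_complete M.
Hypothesis cf : continuous f.
Hypothesis cQ : closed Q.
Hypothesis Q0 : Q !=set0.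
Variable J : set (set X).
Hypothesis sJ : sigma_family J.
Hypothesis J1 : forall x, J [set x].
Hypothesis nJ : forall V, open V -> V `&` Q !=set0 -> ~ J (f @` (V `&` Q)).

(** [embedding] followed by [extension]; the family [J] expresses that [f] is nowhere constant
on [Q]. *)
Lemma absorb (C : set X) (S : nat -> set X) : closed C -> (forall k, closed (S k)) -> C° = set0 ->
  m C = 0 \/ (forall V, open V -> V `&` Q !=set0 -> 0 < m (closure (f @` (V `&` Q)))) /\
    (forall e : R, 0 < e -> exists k, m (C `\` S k) < e) ->
  m C = 0 \/ m C < m (closure (f @` Q)) ->
  exists h, [/\ measure_preserving_homeomorphism mu h,
    forall x, C x -> closure (f @` Q) (h x) &
    forall x, C x -> (forall k, ~ S k x) -> (f @` Q) (h x)].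
Proof.
move=> cC cS iC room large.
have branching V x : open V -> V `&` Q !=set0 -> exists2 y, trace f Q V y & y <> x.
  move=> oV VQ; apply: contrapT => no; apply: (nJ oV VQ).
  have [_ Js _] := sJ; apply: Js (J1 x) => y fy; apply: contrapT => yx.
  by apply: no; exists y.
have [G [t1 t2 Gt Gc GQ]] := embedding cod cont spos cf branching cC cS room iC Mc cQ Q0 large.
have [h [hm hG]] := extension cod spos scond t1 t2.
exists h; split => // x Cx; have [y Gxy] := Gt x Cx; rewrite (hG _ _ Gxy).
  exact: Gc Gxy.
exact: GQ Gxy.
Qed.

End Absorb.

Lemma nonempty_image (M : Type) (f : M -> X) (Q : set M) (J : set (set X)) :
  sigma_family J -> J (f @` (setT `\` Q)) -> ~ J (range f) -> Q !=set0.
Proof.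
move=> [J0 Js _] JQ nJ; apply/set0P/eqP => Q0; apply: nJ.
by apply: Js JQ; rewrite Q0 setD0.
Qed.

(** On a suitable [Q] the map [f] is nowhere countable, hence nowhere constant, and this is
enough room for closed null sets: their pieces fit along every open set that meets [Q]. *)
Lemma closed_null_in A : I A -> ~ countable A -> closed_null_ideal mu `<=` I.
Proof.
move=> IA nA; have [I0 Is IU] := sI; have sJ := @sigma_countable X; have [J0 Js JU] := sJ.
have [|M [f [d [Mc cf dd If Af]]]] := I_param IA.
  by apply/set0P/eqP => A0; apply: nA; rewrite A0; exact: countable0.
have [Q [cQ _ JQ nJ]] := nowhere_small_part f dd sJ (@closedT M).
have Q0 : Q !=set0.
  by apply: nonempty_image sJ JQ _ => h; apply: nA; exact: Js Af h.
have J1 (x : X) : countable [set x] by exact: countable1.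
move=> B [F hF BF]; apply: Is BF _; apply: IU => n.
have [cF mF] := hF n; have mF0 : m (F n) = 0 by rewrite /m mF.
have [|h [hm _ hQ]] := absorb Mc cf cQ Q0 sJ J1 nJ cF (S := fun=> set0) (fun=> closed0)
   (interior_null (Bor_closed cF) mF0) (or_introl mF0).
  by left.
apply: (I_preimage hm If) => x Fx; have [p _ <-] := hQ x Fx (fun _ => id).
by exists p.
Qed.

Lemma null_open_covers B : Bor B -> m B = 0 -> exists U : nat -> set X,
  forall k, [/\ open (U k), B `<=` U k & m (U k) < k.+1%:R^-1].
Proof.
move=> BB mB; suff /choice [U UP] : forall k : nat, exists U,
  [/\ open U, B `<=` U & m U < k.+1%:R^-1] by exists U.
move=> k; have k0 : 0 < k.+1%:R^-1 :> R by rewrite invr_gt0.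
have [[F U] /= [cF oU FB BU]] := regular mu cod BB k0.
rewrite (mD mu (Bor_open oU) (Bor_closed cF) (subset_trans FB BU)) => h.
have mF : m F = 0.
  by apply/eqP; rewrite eq_le m_ge0 andbT -mB; apply: le_m => //; exact: Bor_closed.
by exists U; split => //; move: h; rewrite mF subr0.
Qed.

Lemma singleton_closed_null x : closed_null_ideal mu [set x].
Proof. by apply: (closed_null_mem (C := [set x])) => //; [exact: (closed1 cod)|exact: m1]. Qed.

(** [embedding] requires a closed set of measure less than that of the closure it is mapped
into, so closures of nowhere dense sets are first cut into small cells. *)
Lemma meager_pieces (e : R) Z : 0 < e -> meager_ideal X Z ->
  (forall C, closed C -> C° = set0 -> m C < e -> I (Z `&` C)) -> I Z.
Proof.
move=> e0 [F nF ZE] hI; have [I0 Is IU] := sI.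
have [n hn] := m_small cod cont e0.
apply: (Is _ (\bigcup_k (Z `&` closure (F k)))).
  by move=> x Zx; have := Zx; rewrite {1}ZE => -[k _ Fx]; exists k => //;
    split => //; exact: subset_closure.
apply: IU => k; apply: (sigma_seq sI (s := cells phi n) (F := id)).
  by move=> x _; exact: cells_cover.
move=> D /(cellsP cod) [cD sD]; rewrite -setIA; apply: hI.
- by apply: closedI; [exact: closed_closure|exact: cD.2].
- by apply/seteqP; split=> // x; rewrite -(nF k); apply: interiorS => y [].
- apply: (hn (closure (F k) `&` D)); first by apply: small_sub sD => x [].
  by apply: measurableI; [apply: Bor_closed; exact: closed_closure|exact: Bor_clopen].
Qed.

(** With [f] nowhere in the ideal of closed null sets, the closure of every trace has positive
measure. A null set is avoided by the complements of its open neighbourhoods [U k], which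
almost fill [C], so its points are sent into the range of [f]. *)
Lemma meager_null_in A : I A -> ~ closed_null_ideal mu A -> meager_ideal X `&` null_ideal mu `<=` I.
Proof.
move=> IA nA; have [I0 Is IU] := sI; have sJ := @sigma_closed_null R X mu; have [J0 Js JU] := sJ.
have [|M [f [d [Mc cf dd If Af]]]] := I_param IA.
  by apply/set0P/eqP => A0; apply: nA; rewrite A0.
have [Q [cQ _ JQ nJ]] := nowhere_small_part f dd sJ (@closedT M).
have Q0 : Q !=set0.
  by apply: nonempty_image sJ JQ _ => h; apply: nA; exact: Js Af h.
have pos V : open V -> V `&` Q !=set0 -> 0 < m (closure (f @` (V `&` Q))).
  move=> oV VQ; rewrite lt0r m_ge0 andbT; apply/eqP => e; apply: (nJ V oV VQ).
  by apply: closed_null_mem e _; [exact: closed_closure|exact: subset_closure].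
have pQ : 0 < m (closure (f @` Q)).
  by have := pos setT openT; rewrite setTI; apply.
move=> Z [mZ /nullP [B [BB mB ZB]]]; apply: (meager_pieces pQ mZ) => C cC iC mC.
have [U UP] := null_open_covers BB mB.
have room : forall e : R, 0 < e -> exists k, m (C `\` ~` U k) < e.
  move=> e e0; have [k] := ltr_add_invr e0; rewrite add0r => ke; exists k.
  have [oU _ hU] := UP k; apply: lt_trans ke; apply: le_lt_trans hU.
  have BU := Bor_open oU; rewrite setDE setCK; apply: le_m => //.
  by apply: measurableI => //; exact: Bor_closed.
have cU k : closed (~` U k) by apply: open_closedC; case: (UP k).
have [h [hm _ hQ]] := absorb Mc cf cQ Q0 sJ singleton_closed_null nJ cC cU iC
  (or_intror (conj pos room)) (or_intror mC).
apply: (I_preimage hm If) => x [Zx Cx]; have [|p _ <-] := hQ x Cx _; last by exists p.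
by move=> k; apply; have [_ BU _] := UP k; apply: BU; exact: ZB.
Qed.

Lemma singleton_null x : null_ideal mu [set x].
Proof.
by apply: (null_of_le (B := [set x])) => //; [apply: Bor_closed; exact: (closed1 cod)|rewrite m1].
Qed.

(** A non-null member has a closed part [K] of positive measure; [f] is restricted to the part of
the preimage of [K] where it is nowhere null, and then the whole of [C] goes into [K]. *)
Lemma meager_in A : I A -> ~ null_ideal mu A -> meager_ideal X `<=` I.
Proof.
move=> IA nA; have [I0 Is IU] := sI; have sJ := @sigma_null R X mu; have [J0 Js JU] := sJ.
have [|M [f [d [Mc cf dd If Af]]]] := I_param IA.
  by apply/set0P/eqP => A0; apply: nA; rewrite A0.
have [|K [cK Kf mK]] := range_closed_part cod cf dd Mc (mu := mu).
  by move=> h; apply: nA; exact: Js Af h.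
have cQ1 : closed (f @^-1` K) by apply: preimage_closed => // x _; exact: cf.
have [Q [cQ QQ1 JQ nJ]] := nowhere_small_part f dd sJ cQ1.
have clK : closure (f @` Q) `<=` K.
  rewrite [X in _ `<=` X](closure_id K).1 //; apply: closure_subset => _ [p Qp <-].
  exact: QQ1.
have pos V : open V -> V `&` Q !=set0 -> 0 < m (closure (f @` (V `&` Q))).
  move=> oV VQ; rewrite lt0r m_ge0 andbT; apply/eqP => e; apply: (nJ V oV VQ).
  by apply: (null_of_le (B := closure (f @` (V `&` Q)))); 
    [exact: Bor_closure|rewrite e|exact: subset_closure].
have Q0 : Q !=set0.
  apply/set0P/eqP => Q0; have : null_ideal mu K.
    apply: Js JQ => x Kx; have [p _ px] := Kf x Kx; exists p => //.
    by split; [rewrite /= px|rewrite Q0].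
  move=> /nullP [B [BB mB KB]]; have := le_m mu (Bor_closed cK) BB KB.
  by rewrite mB leNgt mK.
have pQ : 0 < m (closure (f @` Q)).
  by have := pos setT openT; rewrite setTI; apply.
move=> Z mZ; apply: (meager_pieces pQ mZ) => C cC iC mC.
have [||h [hm hQ _]] := absorb Mc cf cQ Q0 sJ singleton_null nJ cC (S := fun=> setT) (fun=> closedT) iC.
- by right; split => // e e0; exists 0%N; rewrite setDT m0.
- by right.
by apply: (I_preimage hm If) => x [_ Cx]; apply: Kf; apply: clK; exact: hQ.
Qed.

Lemma null_preimage h B : measure_preserving_homeomorphism mu h -> null_ideal mu B ->
  null_ideal mu (h @^-1` B).
Proof.
move=> [[g [hg gh ch cg]] hm] /nullP [N [BN mN BsN]].
apply/nullP; exists (h @^-1` N); split; [exact: preimage_Borel| |by move=> x /BsN].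
have := hm _ (preimage_Borel ch BN); rewrite (_ : h @` (h @^-1` N) = N).
  by rewrite /m => <-.
by apply/seteqP; split=> [_ [x Nx <-]//|x Nx]; exists (g x); rewrite /= ?gh.
Qed.

(** A non-meager member is comeager in a nonempty open set [U], whose images under
measure-preserving homeomorphisms cover the space. Inside [U] a null set is covered by the
member up to a set that is both meager and null. *)
Lemma null_in A : I A -> ~ meager_ideal X A -> null_ideal mu `<=` I.
Proof.
move=> IA nA; have [I0 Is IU] := sI; have sM := @sigma_meager X; have [M0 Ms MU] := sM.
have MN : meager_ideal X `&` null_ideal mu `<=` I.
  apply: (meager_null_in IA) => -[F hF AF]; apply: nA; apply: Ms AF _; apply: MU => n.
  have [cF mF] := hF n; apply: meager_closed => //; apply: interior_null; first exact: Bor_closed.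
  by rewrite /m mF.
have [|M [f [d [Mc cf dd If Af]]]] := I_param IA.
  by apply/set0P/eqP => A0; apply: nA; rewrite A0.
have [|U [oU [y Uy] mU']] := range_comeager_part cod cf dd Mc.
  by move=> h; apply: nA; exact: Ms Af h.
move=> B nB.
have local h : measure_preserving_homeomorphism mu h -> I (B `&` h @` U).
  move=> hm; have [[g [hg gh ch cg]] _] := hm.
  have nB' := null_preimage hm nB; have [_ Ns _] := @sigma_null R X mu.
  have IB' : I ((h @^-1` B) `&` U).
    apply: (Is _ (range f `|` ((h @^-1` B) `&` (U `\` range f)))).
      by move=> x [Bx Ux]; case: (pselect (range f x)) => fx; [left|right].
    apply: (sigma_setU sI) => //; apply: MN; split.
      by apply: Ms mU' => x [].
    by apply: Ns nB' => x [].
  apply: Is (I_image hm IB') => x [Bx [z Uz zx]]; exists z => //.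
  by split => //; rewrite /= zx.
pose c (ni : nat * nat) := nth set0 (cells phi ni.1) ni.2.
apply: (Is _ (\bigcup_ni (if `[< I (B `&` c ni) >] then B `&` c ni else set0))); last first.
  by apply: (sigma_bigcup sI) => ni; case: ifP => // /asboolP.
move=> x Bx; have [h [hm hy]] := transitive_action y x.
have [[g [hg gh ch cg]] _] := hm.
have oh : open (h @` U).
  by rewrite (homeo_open hg gh cg); apply: open_comp => // z _; exact: cg.
have [|n hn] := open_thicken1 cod (x := x) oh; first by exists y.
have [D Dn Dx] := cells_cover phi n x.
exists (n, index D (cells phi n)) => //; rewrite /c /= nth_index // asboolT //.
apply: Is (local h hm) => z [Bz Dz]; split => //; apply: hn; rewrite thicken1 /=.
by have [_ sD] := cellsP cod Dn; exact: sD.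
Qed.

(** A countable dense set is null, so it has open neighbourhoods of arbitrarily small measure;
their intersection is null, and its complement is meager. *)
Lemma meager_null_cover : exists Z N, [/\ meager_ideal X Z, null_ideal mu N & setT = Z `|` N].
Proof.
have sN := @sigma_null R X mu.
pose D := \bigcup_(nD : nat * nat) [set xget point (nth set0 (cells phi nD.1) nD.2)].
have /nullP [B [BB mB DB]] : null_ideal mu D.
  by apply: (sigma_bigcup sN) => nD; exact: singleton_null.
have dense_D V : open V -> V !=set0 -> (V `&` D) !=set0.
  move=> oV [x Vx]; have [n hn] := open_thicken1 cod oV Vx.
  have [E En Ex] := cells_cover phi n x.
  have Eg : E (xget point E) by exact: xgetPex (ex_intro _ x Ex).
  exists (xget point E); split.
    by apply: hn; rewrite thicken1 /=; have [_ sE] := cellsP cod En; exact: sE.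
  by exists (n, index E (cells phi n)) => //=; rewrite nth_index.
have [U UP] := null_open_covers BB mB.
exists (\bigcup_k ~` U k), (\bigcap_k U k); split; last by rewrite -setC_bigcap setvU.
- exists (fun k => ~` U k) => // k; have [oU BU _] := UP k.
  rewrite /nowhere_dense -(closure_id _).1; last exact: open_closedC.
  apply/seteqP; split=> // x h.
  have [|y [hy Dy]] := dense_D (~` U k)° (@open_interior _ _); first by exists x.
  by apply: (interior_subset hy); apply: BU; exact: DB.
- have BI : Bor (\bigcap_k U k) by apply: bigcapT_measurable => k; apply: Bor_open; case: (UP k).
  apply: (null_of_le BI) => //; apply/ler_addgt0Pr => e e0.
  have [k] := ltr_add_invr e0; rewrite !add0r => ke; have [oU _ hU] := UP k.
  apply/ltW; apply: lt_trans ke; apply: le_lt_trans hU.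
  by apply: (le_m mu BI (Bor_open oU)); exact: bigcap_inf.
Qed.

Lemma classification :
  I = card_le_ideal X (@set0 nat) \/ I = card_le_ideal X [set: nat] \/
  I = closed_null_ideal mu \/ I = meager_ideal X `&` null_ideal mu \/
  I = meager_ideal X \/ I = null_ideal mu \/ I = card_le_ideal X [set: R].
Proof.
have [I0 Is IU] := sI.
have not_sub (J : set (set X)) : ~ I `<=` J -> exists2 A, I A & ~ J A.
  move=> h; apply: contrapT => no; apply: h => A IA; apply: contrapT => JA.
  by apply: no; exists A.
have [s0|/not_sub [A0 IA0 nA0]] := pselect (I `<=` card_le_ideal X (@set0 nat)).
  left; apply/seteqP; split=> // A; rewrite /card_le_ideal /= card_le0 => /eqP ->.
  exact: I0.
have A00 : A0 !=set0.
  by apply/set0P/eqP => e; apply: nA0; rewrite e /card_le_ideal /= card_le0.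
right; have [s1|/not_sub [A1 IA1 nA1]] := pselect (I `<=` card_le_ideal X [set: nat]).
  by left; apply/seteqP; split=> // A; exact: countable_in IA0 A00 A.
right; have E := closed_null_in IA1 nA1.
have [s2|/not_sub [A2 IA2 nA2]] := pselect (I `<=` closed_null_ideal mu).
  by left; apply/seteqP; split.
right; have MN := meager_null_in IA2 nA2.
have [sM|/not_sub [A3 IA3 nA3]] := pselect (I `<=` meager_ideal X).
  have [sN|/not_sub [A4 IA4 nA4]] := pselect (I `<=` null_ideal mu).
    by left; apply/seteqP; split=> // A IA; split; [exact: sM|exact: sN].
  by right; left; apply/seteqP; split=> //; exact: meager_in IA4 nA4.
have Nu := null_in IA3 nA3.
have [sN|/not_sub [A4 IA4 nA4]] := pselect (I `<=` null_ideal mu).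
  by right; right; left; apply/seteqP; split.
have Me := meager_in IA4 nA4.
do 3 right; apply/seteqP; split=> A _.
  have [g ginj] := sequence_injection R.
  by apply/pcard_injP; exists (g \o phi) => x y _ _ /ginj; exact: cod_inj.
have [Z [N [mZ nN e]]] := meager_null_cover.
apply: (Is _ setT) => //; rewrite e; apply: (sigma_setU sI); [exact: Me|exact: Nu].
Qed.

End Classification.

Theorem theorem1p1 (R : realType) (X : ptopologicalType)
    (mu : {finite_measure set (borelType X) -> \bar R})
    (I : set (set X)) :
  good_cantor_measure_space mu ->
  sigma_ideal I -> analytic_base R I -> invariant_family mu I ->
  I = card_le_ideal X (@set0 nat) \/
  I = card_le_ideal X [set: nat] \/
  I = closed_null_ideal mu \/
  I = meager_ideal X `&` null_ideal mu \/
  I = meager_ideal X \/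
  I = null_ideal mu \/
  I = card_le_ideal X [set: R].
Proof.
move=> [[hX cont] spos scond] sI ab inv.
have [phi cod] := homeomorphic_cantor_coding hX.
exact: (classification cod cont spos scond (sigma_ideal_family sI) ab inv).
Qed.
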